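(* Let $d\ge2$ and $n=\lfloor d/2\rfloor$. For every $\lambda\in\mathbb{R}^d$ there is a neighborhood $U$ of the origin in $\mathbb{R}^2$ such that the system $\dot x=y$, $\dot y=-x+p(x)y$ has at most $n-1$ limit cycles (isolated periodic orbits) contained in $U$.
   Context: $\lambda=(\lambda_1,\dots,\lambda_d)$ are real parameters and $p(x)=\sum_{i=1}^d\lambda_i x^i$. *)

(* Defs.v *)
From Stdlib Require Import Reals.
From Coquelicot Require Import Coquelicot.
Open Scope R_scope.

(* p(x) = sum_{i=1}^k lam i * x^i  (lam i plays the role of lambda_i; lam 0 unused) *)
Fixpoint poly_p (lam : nat -> R) (k : nat) (x : R) : R :=
  match k with
  | O => 0
  | S k' => poly_p lam k' x + lam (S k') * x ^ (S k')
  end.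

Definition pt := (R * R)%type.
Definition pset := pt -> Prop.

Definition dist2 (P Q : pt) : R := (fst P - fst Q) ^ 2 + (snd P - snd Q) ^ 2.

Definition open_set (V : pset) : Prop :=
  forall P, V P -> exists e, 0 < e /\ forall Q, dist2 P Q < e ^ 2 -> V Q.

Definition subset (A B : pset) : Prop := forall P, A P -> B P.
Definition same_set (A B : pset) : Prop := forall P, A P <-> B P.

Definition is_solution (d : nat) (lam : nat -> R) (x y : R -> R) : Prop :=
  (forall t, is_derive x t (y t)) /\
  (forall t, is_derive y t (- x t + poly_p lam d (x t) * y t)).

Definition periodic_orbit (d : nat) (lam : nat -> R) (G : pset) : Prop :=
  exists (x y : R -> R) (T : R),
    is_solution d lam x y /\ 0 < T /\
    (forall t, x (t + T) = x t /\ y (t + T) = y t) /\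
    (exists t, (x t, y t) <> (x 0, y 0)) /\
    (forall P, G P <-> exists t, P = (x t, y t)).

Definition limit_cycle (d : nat) (lam : nat -> R) (G : pset) : Prop :=
  periodic_orbit d lam G /\
  exists V, open_set V /\ subset G V /\
    forall G', periodic_orbit d lam G' -> subset G' V -> same_set G' G.

Definition origin : pt := (0, 0).

(* Main.v *)
Require Import Defs.
From Stdlib Require Import Reals ZArith Lra Lia Classical ClassicalEpsilon.
From Coquelicot Require Import Coquelicot.
Open Scope R_scope.

(** For fixed [lam] a small enough disc contains no limit cycle at all. In the Lienard
    coordinates [z = y - P(x)], with [P' = p] and [P(0) = 0], the system becomes
    [x' = z + P(x)], [z' = -x].

    If [P] is even, the system is reversible under [(x, z, t) -> (-x, z, -t)]. Start a solution on
    the [z]-axis slightly above the highest point of a periodic orbit: by Gronwall it follows the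
    orbit until it meets the [z]-axis again, and reversibility closes it up. So no periodic orbit
    is isolated.

    Otherwise [P(s) - P(-s)] has a constant sign for small [s > 0], positive after time reversal.
    Follow a periodic orbit from its highest point through the half plane [x > 0] and then through
    [x < 0]. Both halves are graphs over the [z]-axis of functions [u = x^2/2] with
    [du/dz = -(z + P(x))]. As the even part of [P] is Lipschitz in [x^2], the difference [D] of
    the two functions satisfies [D' < K |D|] and vanishes at the lowest point, so [D < 0] at the
    end of the second half, where [D >= 0] by maximality of the starting height. *)

(** * Lienard systems in the plane *)

(** The bound is global so that solutions exist for all times; a polynomial acquires it once its
    argument is clamped to a bounded interval. *)
Definition lipschitz (L : R) (g : R -> R) : Prop :=
  0 <= L /\ forall u v, Rabs (g u - g v) <= L * Rabs (u - v).

Definition lienard (g x z : R -> R) : Prop :=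
  (forall t, is_derive x t (z t + g (x t))) /\ (forall t, is_derive z t (- x t)).

(** * One-variable calculus: mean values, signs and first zeros *)

Lemma is_derive_continuity_pt (f : R -> R) (t l : R) :
  is_derive f t l -> continuity_pt f t.
Proof.
  intros H; apply continuity_pt_filterlim.
  apply (ex_derive_continuous f t); now exists l.
Qed.

Lemma mean_value_open (f df : R -> R) (a b : R) :
  a < b ->
  (forall t, a <= t <= b -> continuity_pt f t) ->
  (forall t, a < t < b -> is_derive f t (df t)) ->
  exists c, a < c < b /\ f b - f a = df c * (b - a).
Proof.
  intros Hab Hc Hd.
  assert (pr1 : forall c, a < c < b -> derivable_pt f c).
  { intros c Hcc; exists (df c); apply is_derive_Reals; auto. }
  destruct (MVT f id a b pr1 (fun c _ => derivable_pt_id c) Hab Hc) as [c [P E]].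
  { intros c _; apply derivable_continuous_pt, derivable_pt_id. }
  exists c; split; [exact P|].
  rewrite derive_pt_id in E.
  assert (Ed : derive_pt f c (pr1 c P) = df c).
  { apply derive_pt_eq_0, is_derive_Reals; auto. }
  rewrite Ed in E; unfold id in E; lra.
Qed.

Lemma derive_nonneg_le (f df : R -> R) (a b : R) :
  a <= b -> (forall t, a <= t <= b -> is_derive f t (df t)) ->
  (forall t, a < t < b -> 0 <= df t) -> f a <= f b.
Proof.
  intros [Hab | ->] Hd Hp; [|lra].
  destruct (mean_value_open f df a b Hab) as [c [Hc E]].
  - intros t Ht; eapply is_derive_continuity_pt; eauto.
  - intros t Ht; apply Hd; lra.
  - specialize (Hp c Hc); nra.
Qed.

Lemma continuity_pt_pos_nbhd (f : R -> R) (t : R) :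
  continuity_pt f t -> 0 < f t ->
  exists e, 0 < e /\ forall s, Rabs (s - t) < e -> 0 < f s.
Proof.
  intros Hc Hp.
  destruct (Hc (f t) Hp) as [e [He H]]; exists e; split; [exact He|].
  intros s Hs.
  destruct (Req_dec t s) as [<-|Hne]; [exact Hp|].
  specialize (H s (conj (conj I Hne) Hs)); unfold dist in H; simpl in H.
  unfold R_dist in H; apply Rabs_def2 in H; lra.
Qed.

Lemma derive_pos_right (f : R -> R) (t l : R) :
  is_derive f t l -> 0 < l -> f t = 0 ->
  exists e, 0 < e /\ forall s, t < s < t + e -> 0 < f s.
Proof.
  intros Hd Hl H0; apply is_derive_Reals in Hd.
  destruct (Hd l Hl) as [e He]; exists e; split; [apply cond_pos|].
  intros s Hs.
  assert (Hh : s - t <> 0) by lra.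
  assert (Ha : Rabs (s - t) < e) by (rewrite Rabs_pos_eq; lra).
  specialize (He (s - t) Hh Ha).
  replace (t + (s - t)) with s in He by ring; rewrite H0, Rminus_0_r in He.
  apply Rabs_def2 in He.
  assert (0 < f s / (s - t)) by lra.
  replace (f s) with (f s / (s - t) * (s - t)) by (field; lra).
  apply Rmult_lt_0_compat; lra.
Qed.

(** The zero is the supremum of the end points of the intervals of positivity. Positivity is asked
    only to the right of [a] because in the application [f] vanishes at [a]. *)
Lemma first_zero (f : R -> R) (a b e : R) :
  (forall t, continuity_pt f t) -> 0 < e -> a < b ->
  (forall s, a < s < a + e -> 0 < f s) -> f b <= 0 ->
  exists c, a < c <= b /\ f c = 0 /\ forall s, a < s < c -> 0 < f s.
Proof.
  intros Hf He Hab Hpos Hb.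
  set (E := fun s => a < s <= b /\ forall r, a < r < s -> 0 < f r).
  destruct (completeness E) as [c [Hub Hlub]].
  { exists b; intros s [Hs _]; lra. }
  { exists (Rmin b (a + e)); split.
    - split; [apply Rmin_glb_lt; lra | apply Rmin_l].
    - intros r Hr; apply Hpos; generalize (Rmin_r b (a + e)); lra. }
  assert (Hac : a < c).
  { assert (a < Rmin b (a + e)) by (apply Rmin_glb_lt; lra).
    apply Rlt_le_trans with (1 := H), Hub; split.
    - split; [lra | apply Rmin_l].
    - intros r Hr; apply Hpos; generalize (Rmin_r b (a + e)); lra. }
  assert (Hcb : c <= b) by (apply Hlub; intros s [Hs _]; lra).
  assert (Hin : forall s, a < s < c -> 0 < f s).
  { intros s Hs; destruct (Rlt_dec 0 (f s)) as [|Hn]; [assumption|exfalso].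
    assert (c <= s); [|lra].
    apply Hlub; intros q [Hq1 Hq2]; destruct (Rle_dec q s); [assumption|].
    exfalso; apply Hn, Hq2; lra. }
  exists c; split; [lra|split; [|exact Hin]].
  destruct (Rtotal_order (f c) 0) as [Hn|[H0|Hp]]; [|exact H0|].
  - destruct (continuity_pt_pos_nbhd (fun s => - f s) c) as [d [Hd H]].
    { apply continuity_pt_opp, Hf. }
    { lra. }
    assert (Hm : a < Rmax ((a + c) / 2) (c - d / 2) < c).
    { split; [apply Rlt_le_trans with ((a + c) / 2); [lra|apply Rmax_l]|].
      apply Rmax_lub_lt; lra. }
    assert (c - d / 2 <= Rmax ((a + c) / 2) (c - d / 2)) by apply Rmax_r.
    specialize (H (Rmax ((a + c) / 2) (c - d / 2))).
    specialize (Hin _ Hm).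
    assert (0 < - f (Rmax ((a + c) / 2) (c - d / 2))); [|lra].
    apply H, Rabs_def1; lra.
  - destruct (continuity_pt_pos_nbhd f c (Hf c) Hp) as [d [Hd H]].
    assert (Hcb' : c < b) by (destruct Hcb as [|Hcb]; [assumption|subst; lra]).
    assert (Hs : c < Rmin b (c + d)) by (apply Rmin_glb_lt; lra).
    assert (Rmin b (c + d) <= c); [|lra].
    apply Hub; split.
    + split; [lra | apply Rmin_l].
    + intros r Hr; destruct (Rlt_le_dec r c) as [|Hrc]; [apply Hin; lra|].
      apply H; generalize (Rmin_r b (c + d)); intros.
      apply Rabs_def1; lra.
Qed.

(** * Reduction of periodic functions to one period *)

Lemma periodic_INR (f : R -> R) (T : R) :
  (forall t, f (t + T) = f t) -> forall n t, f (t + INR n * T) = f t.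
Proof.
  intros H n; induction n as [|n IH]; intros t.
  - simpl; f_equal; ring.
  - rewrite S_INR, <- (IH t), <- (H (t + INR n * T)); f_equal; ring.
Qed.

Lemma periodic_IZR (f : R -> R) (T : R) :
  (forall t, f (t + T) = f t) -> forall n t, f (t + IZR n * T) = f t.
Proof.
  intros H n t; destruct (Z.le_gt_cases 0 n) as [Hn|Hn].
  - rewrite <- (Z2Nat.id n Hn), <- INR_IZR_INZ; now apply periodic_INR.
  - rewrite <- (periodic_INR f T H (Z.to_nat (- n)) (t + IZR n * T)).
    f_equal; rewrite INR_IZR_INZ, Z2Nat.id, opp_IZR by lia; ring.
Qed.

(** One representative [s] serves every function of period [T], so that both coordinates of an orbit
    can be reduced together. *)
Lemma periodic_reduce (T a t : R) : 0 < T ->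
  exists s, a <= s < a + T /\
    forall f : R -> R, (forall t, f (t + T) = f t) -> f t = f s.
Proof.
  intros HT; set (n := Int_part ((t - a) / T)).
  destruct (base_Int_part ((t - a) / T)) as [H1 H2]; fold n in H1, H2.
  exists (t + IZR (- n) * T); split.
  - rewrite opp_IZR.
    assert (E : (t - a) / T * T = t - a) by (field; lra).
    assert (IZR n * T <= (t - a) / T * T) by (apply Rmult_le_compat_r; lra).
    assert ((t - a) / T * T < (IZR n + 1) * T) by (apply Rmult_lt_compat_r; lra).
    lra.
  - intros f Hf; now rewrite periodic_IZR.
Qed.

(** * Continuity and symmetries of Lienard solutions *)

Ltac rewrite_derive H :=
  match goal with
  | |- context [Derive ?f ?t] => rewrite (is_derive_unique f t _ (H t))
  end.

Lemma lienard_continuity (g x z : R -> R) :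
  lienard g x z -> (forall t, continuity_pt x t) /\ (forall t, continuity_pt z t).
Proof.
  intros [Hx Hz]; split; intros t; eapply is_derive_continuity_pt; eauto.
Qed.

Lemma lienard_shift (g x z : R -> R) (a : R) :
  lienard g x z -> lienard g (fun t => x (t + a)) (fun t => z (t + a)).
Proof.
  intros [Hx Hz]; split; intros t.
  - auto_derive; [repeat split; eexists; apply Hx|].
    rewrite_derive Hx; ring.
  - auto_derive; [repeat split; eexists; apply Hz|].
    rewrite_derive Hz; ring.
Qed.

(** Time reversal combined with x -> -x keeps the form of the system and reflects [g]; for even [g]
    it maps solutions to solutions of the same system. *)
Lemma lienard_reverse (g x z : R -> R) (a : R) :
  lienard g x z ->
  lienard (fun u => g (- u)) (fun t => - x (a - t)) (fun t => z (a - t)).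
Proof.
  intros [Hx Hz]; split; intros t.
  - auto_derive; [repeat split; eexists; apply Hx|].
    replace (a + - t) with (a - t) by ring.
    rewrite_derive Hx; rewrite ?Ropp_involutive; ring.
  - auto_derive; [repeat split; eexists; apply Hz|].
    replace (a + - t) with (a - t) by ring.
    rewrite_derive Hz; ring.
Qed.

(** Rotation by half a turn, by which arcs in x < 0 become arcs in x > 0. *)
Lemma lienard_opp (g x z : R -> R) :
  lienard g x z ->
  lienard (fun u => - g (- u)) (fun t => - x t) (fun t => - z t).
Proof.
  intros [Hx Hz]; split; intros t.
  - auto_derive; [repeat split; eexists; apply Hx|].
    rewrite_derive Hx; rewrite ?Ropp_involutive; ring.
  - auto_derive; [repeat split; eexists; apply Hz|].
    rewrite_derive Hz; ring.
Qed.

Lemma lipschitz_reverse (L : R) (g : R -> R) :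
  lipschitz L g -> lipschitz L (fun u => g (- u)).
Proof.
  intros [HL Hg]; split; [exact HL|]; intros u v.
  eapply Rle_trans; [apply Hg|].
  replace (- u - - v) with (- (u - v)) by ring; rewrite Rabs_Ropp; lra.
Qed.

Lemma lipschitz_opp (L : R) (g : R -> R) :
  lipschitz L g -> lipschitz L (fun u => - g (- u)).
Proof.
  intros Hg; destruct (lipschitz_reverse L g Hg) as [HL H]; split; [exact HL|].
  intros u v; replace (- g (- u) - - g (- v)) with (- (g (- u) - g (- v))) by ring.
  rewrite Rabs_Ropp; apply H.
Qed.

(** * Gronwall estimate and uniqueness *)

Definition sqdist (x1 z1 x2 z2 : R -> R) (t : R) : R :=
  (x1 t - x2 t) ^ 2 + (z1 t - z2 t) ^ 2.

(* The rotation part of the field preserves the distance, so only [g] contributes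
   to its growth. *)
Lemma gronwall_forward (L : R) (g x1 z1 x2 z2 : R -> R) (s t : R) :
  lipschitz L g -> lienard g x1 z1 -> lienard g x2 z2 -> s <= t ->
  sqdist x1 z1 x2 z2 t <= sqdist x1 z1 x2 z2 s * exp (2 * L * (t - s)).
Proof.
  intros [HL Hg] [Hx1 Hz1] [Hx2 Hz2] Hst.
  set (E := sqdist x1 z1 x2 z2).
  assert (H : - (E s * exp (- (2 * L) * s)) <= - (E t * exp (- (2 * L) * t))).
  { apply (derive_nonneg_le (fun r => - (E r * exp (- (2 * L) * r)))
      (fun r => (2 * L * E r - 2 * (x1 r - x2 r) * (g (x1 r) - g (x2 r)))
                * exp (- (2 * L) * r)) s t Hst).
    - intros r _; unfold E, sqdist; auto_derive.
      + repeat split; eexists; eauto.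
      + rewrite_derive Hx1; rewrite_derive Hx2; rewrite_derive Hz1; rewrite_derive Hz2; ring.
    - intros r _; apply Rmult_le_pos; [|left; apply exp_pos].
      specialize (Hg (x1 r) (x2 r)).
      assert (H1 : (x1 r - x2 r) * (g (x1 r) - g (x2 r)) <= L * (x1 r - x2 r) ^ 2).
      { eapply Rle_trans; [apply Rle_abs|]; rewrite Rabs_mult, <- pow2_abs.
        assert (0 <= Rabs (x1 r - x2 r)) by apply Rabs_pos; nra. }
      assert (0 <= L * (z1 r - z2 r) ^ 2) by (apply Rmult_le_pos; [lra|apply pow2_ge_0]).
      unfold E, sqdist; lra. }
  replace (2 * L * (t - s)) with (- (2 * L) * s + 2 * L * t) by ring.
  rewrite exp_plus, <- Rmult_assoc.
  replace (E t) with (E t * exp (- (2 * L) * t) * exp (2 * L * t)).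
  - apply Rmult_le_compat_r; [left; apply exp_pos | lra].
  - rewrite Rmult_assoc, <- exp_plus.
    replace (- (2 * L) * t + 2 * L * t) with 0 by ring; rewrite exp_0; ring.
Qed.

Lemma lienard_unique_forward (L : R) (g x1 z1 x2 z2 : R -> R) (s t : R) :
  lipschitz L g -> lienard g x1 z1 -> lienard g x2 z2 -> s <= t ->
  x1 s = x2 s -> z1 s = z2 s -> x1 t = x2 t /\ z1 t = z2 t.
Proof.
  intros Hg H1 H2 Hst Ex Ez.
  assert (H := gronwall_forward L g x1 z1 x2 z2 s t Hg H1 H2 Hst).
  unfold sqdist in H; rewrite Ex, Ez in H.
  assert (0 <= (x1 t - x2 t) ^ 2) by apply pow2_ge_0.
  assert (0 <= (z1 t - z2 t) ^ 2) by apply pow2_ge_0.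
  replace ((x2 s - x2 s) ^ 2 + (z2 s - z2 s) ^ 2) with 0 in H by ring.
  assert (A : x1 t - x2 t = 0) by nra.
  assert (B : z1 t - z2 t = 0) by nra.
  lra.
Qed.

Lemma lienard_unique (L : R) (g x1 z1 x2 z2 : R -> R) (s t : R) :
  lipschitz L g -> lienard g x1 z1 -> lienard g x2 z2 ->
  x1 s = x2 s -> z1 s = z2 s -> x1 t = x2 t /\ z1 t = z2 t.
Proof.
  intros Hg H1 H2 Ex Ez; destruct (Rle_dec s t) as [Hst|Hst].
  - eapply lienard_unique_forward; eauto.
  (* Earlier times are reached by reversing time, which keeps the Lipschitz constant. *)
  - destruct (lienard_unique_forward L (fun u => g (- u))
      (fun r => - x1 (0 - r)) (fun r => z1 (0 - r))
      (fun r => - x2 (0 - r)) (fun r => z2 (0 - r)) (- s) (- t)) as [A B].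
    + now apply lipschitz_reverse.
    + now apply lienard_reverse.
    + now apply lienard_reverse.
    + lra.
    + replace (0 - - s) with s by ring; now rewrite Ex.
    + now replace (0 - - s) with s by ring.
    + replace (0 - - t) with t in A, B by ring; split; [lra|exact B].
Qed.

Lemma lienard_zero (g : R -> R) : g 0 = 0 -> lienard g (fun _ => 0) (fun _ => 0).
Proof.
  intros H; split; intros t; [rewrite H, Rplus_0_r | rewrite Ropp_0];
    apply (is_derive_const 0).
Qed.

(** * Periodic solutions: highest point and arcs in a half plane *)

Definition cyclic (T : R) (x z : R -> R) : Prop :=
  0 < T /\ (forall t, x (t + T) = x t) /\ (forall t, z (t + T) = z t) /\
  exists t, (x t, z t) <> (x 0, z 0).

(** By uniqueness a solution through the equilibrium is constant. *)
Lemma cyclic_avoids_origin (L : R) (g x z : R -> R) (T t : R) :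
  lipschitz L g -> g 0 = 0 -> lienard g x z -> cyclic T x z ->
  x t = 0 -> z t <> 0.
Proof.
  intros Hg H0 Hs [_ [_ [_ [s Hne]]]] Ex Ez; apply Hne.
  assert (H : forall r, x r = 0 /\ z r = 0).
  { intros r; apply (lienard_unique L g x z (fun _ => 0) (fun _ => 0) t r); auto.
    now apply lienard_zero. }
  destruct (H s) as [-> ->]; destruct (H 0) as [-> ->]; reflexivity.
Qed.

(** At a maximum of [z] the equation z' = -x gives x = 0. At negative height [x] would turn negative
    right afterwards, and [z] would rise above its maximum. *)
Lemma cyclic_max (L : R) (g x z : R -> R) (T : R) :
  lipschitz L g -> g 0 = 0 -> lienard g x z -> cyclic T x z ->
  exists t0, x t0 = 0 /\ 0 < z t0 /\ forall t, z t <= z t0.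
Proof.
  intros Hg H0 Hs Hc.
  destruct (lienard_continuity g x z Hs) as [Cx Cz].
  assert (HT : 0 < T) by apply Hc.
  assert (Hpz : forall t, z (t + T) = z t) by apply Hc.
  destruct (continuity_ab_maj z 0 T) as [t0 [Hm _]]; [lra|auto|].
  assert (Hmax : forall t, z t <= z t0).
  { intros t; destruct (periodic_reduce T 0 t HT) as [s [Hs' E]].
    rewrite (E z Hpz); apply Hm; lra. }
  destruct Hs as [Hx Hz].
  assert (Hx0 : x t0 = 0).
  { assert (pr : derivable_pt z t0) by (exists (- x t0); apply is_derive_Reals, Hz).
    assert (E1 : derive_pt z t0 pr = - x t0)
      by (apply derive_pt_eq_0, is_derive_Reals, Hz).
    assert (E2 : derive_pt z t0 pr = 0).
    { apply (deriv_maximum z (t0 - 1) (t0 + 1)); [lra|lra|]; auto. }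
    lra. }
  exists t0; split; [exact Hx0|split; [|exact Hmax]].
  assert (Hne := cyclic_avoids_origin L g x z T t0 Hg H0 (conj Hx Hz) Hc Hx0).
  destruct (Rlt_dec 0 (z t0)) as [|Hn]; [assumption|exfalso].
  destruct (derive_pos_right (fun t => - x t) t0 (- z t0)) as [e [He Hp]].
  - generalize (Hx t0); rewrite Hx0, H0, Rplus_0_r; intros.
    now apply (is_derive_opp x).
  - lra.
  - lra.
  - destruct (mean_value_open z (fun t => - x t) t0 (t0 + e)) as [c [Hcc E]];
      [lra| intros; apply Cz | intros; apply Hz |].
    specialize (Hp c Hcc); specialize (Hmax (t0 + e)); nra.
Qed.

(** From the positive z-axis the solution enters x > 0, where [z] strictly decreases; as [z] is
    periodic, it must leave this half plane, and it can do so only at negative [z]. *)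
Lemma cyclic_right_arc (L : R) (g x z : R -> R) (T t0 : R) :
  lipschitz L g -> g 0 = 0 -> lienard g x z -> cyclic T x z ->
  x t0 = 0 -> 0 < z t0 ->
  exists t1, t0 < t1 /\ x t1 = 0 /\ z t1 < 0 /\ forall t, t0 < t < t1 -> 0 < x t.
Proof.
  intros Hg H0 Hs Hc Hx0 Hz0.
  destruct (lienard_continuity g x z Hs) as [Cx Cz].
  assert (Hs' := Hs); destruct Hs' as [Hx Hz].
  assert (HT : 0 < T) by apply Hc.
  assert (Hpz : forall t, z (t + T) = z t) by apply Hc.
  destruct (derive_pos_right x t0 (z t0)) as [e [He Hp]]; auto.
  { generalize (Hx t0); now rewrite Hx0, H0, Rplus_0_r. }
  assert (Hneg : exists b, t0 < b /\ x b <= 0).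
  { apply NNPP; intros Hn.
    assert (Hpos : forall b, t0 < b -> 0 < x b).
    { intros b Hb; destruct (Rlt_dec 0 (x b)); [assumption|].
      exfalso; apply Hn; exists b; split; lra. }
    destruct (mean_value_open z (fun t => - x t) t0 (t0 + T)) as [c [Hcc E]];
      [lra| intros; apply Cz | intros; apply Hz |].
    rewrite Hpz in E; specialize (Hpos c (proj1 Hcc)); nra. }
  destruct Hneg as [b [Hb Hxb]].
  destruct (first_zero x t0 b e Cx He Hb Hp Hxb) as [t1 [Ht1 [E1 Hpos]]].
  exists t1; split; [lra|split; [exact E1|split; [|exact Hpos]]].
  assert (Hne := cyclic_avoids_origin L g x z T t1 Hg H0 Hs Hc E1).
  destruct (Rlt_dec (z t1) 0) as [|Hn]; [assumption|exfalso].
  (* Reflecting time about [t1] gives the sign to the left of the zero: with [z t1 > 0], [x] would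
     be negative just before [t1]. *)
  destruct (derive_pos_right (fun t => - x (t1 - (t - t1))) t1 (z t1)) as [d [Hd Hq]].
  - auto_derive.
    + repeat split; eexists; apply Hx.
    + replace (t1 + - (t1 + - t1)) with t1 by ring.
      rewrite_derive Hx; rewrite ?E1, H0; ring.
  - lra.
  - replace (t1 - (t1 - t1)) with t1 by ring; lra.
  - set (h := Rmin (d / 2) ((t1 - t0) / 2)).
    assert (0 < h) by (apply Rmin_glb_lt; lra).
    assert (h <= d / 2) by apply Rmin_l.
    assert (h <= (t1 - t0) / 2) by apply Rmin_r.
    specialize (Hq (t1 + h)); specialize (Hpos (t1 - h)).
    replace (t1 - (t1 + h - t1)) with (t1 - h) in Hq by ring; lra.
Qed.

Lemma cyclic_opp (T : R) (x z : R -> R) :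
  cyclic T x z -> cyclic T (fun t => - x t) (fun t => - z t).
Proof.
  intros [HT [Hx [Hz [t Hne]]]]; repeat split; auto.
  - intros s; now rewrite Hx.
  - intros s; now rewrite Hz.
  - exists t; intros E; apply Hne; injection E; intros; f_equal; lra.
Qed.

Lemma cyclic_reverse (T : R) (x z : R -> R) :
  cyclic T x z -> cyclic T (fun t => - x (0 - t)) (fun t => z (0 - t)).
Proof.
  intros [HT [Hx [Hz [t Hne]]]]; repeat split; auto.
  - intros s; f_equal; rewrite <- Hx; f_equal; ring.
  - intros s; rewrite <- Hz; f_equal; ring.
  - exists (- t); intros E; apply Hne.
    replace (0 - - t) with t in E by ring; replace (0 - 0) with 0 in E by ring.
    injection E; intros; f_equal; lra.
Qed.

(** * Arcs as graphs over the z-axis *)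

(** Serves twice: to extend the inverse of [z] beyond its range, and to make a polynomial globally
    Lipschitz. *)
Definition clamp (a b u : R) : R := Rmax a (Rmin b u).

Lemma clamp_bounds (a b u : R) : a <= b -> a <= clamp a b u <= b.
Proof.
  intros H; unfold clamp, Rmax, Rmin; repeat destruct Rle_dec; lra.
Qed.

Lemma clamp_id (a b u : R) : a <= u <= b -> clamp a b u = u.
Proof.
  intros H; unfold clamp, Rmax, Rmin; repeat destruct Rle_dec; lra.
Qed.

Lemma clamp_lipschitz (a b u v : R) :
  a <= b -> Rabs (clamp a b u - clamp a b v) <= Rabs (u - v).
Proof.
  intros H; unfold clamp, Rmax, Rmin, Rabs;
    repeat destruct Rle_dec; repeat destruct Rcase_abs; lra.
Qed.

(** The inverse of [z] on [t0, t1] is made total by clamping its argument to the range. The mean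
    value theorem gives strict monotonicity up to the end points, where [dz] may vanish. *)
Lemma decreasing_inverse (z dz : R -> R) (t0 t1 : R) :
  t0 < t1 -> (forall t, is_derive z t (dz t)) -> (forall t, t0 < t < t1 -> dz t < 0) ->
  exists s : R -> R,
    (forall c, continuity_pt s c) /\
    (forall t, t0 <= t <= t1 -> s (z t) = t) /\
    (forall c, z t1 < c < z t0 -> t0 < s c < t1 /\ z (s c) = c).
Proof.
  intros H01 Hz Hneg.
  assert (Cz : forall t, continuity_pt z t)
    by (intros t; eapply is_derive_continuity_pt; eauto).
  assert (Hdec : forall u v, t0 <= u -> u < v -> v <= t1 -> z v < z u).
  { intros u v Hu Huv Hv.
    destruct (mean_value_open z dz u v Huv) as [c [Hc E]]; auto.
    assert (dz c < 0) by (apply Hneg; lra); nra. }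
  assert (Hz10 : z t1 < z t0) by (apply Hdec; lra).
  assert (Hex : forall c, exists s, t0 <= s <= t1 /\ z s = clamp (z t1) (z t0) c).
  { intros c; assert (Hc := clamp_bounds (z t1) (z t0) c (Rlt_le _ _ Hz10)).
    set (k := clamp (z t1) (z t0) c) in *.
    destruct (Req_dec k (z t1)) as [E1|N1]; [exists t1; split; [lra|auto]|].
    destruct (Req_dec k (z t0)) as [E0|N0]; [exists t0; split; [lra|auto]|].
    destruct (IVT (fun t => k - z t) t0 t1) as [s [Hs E]]; [|lra|lra|lra|].
    - intros t; apply continuity_pt_minus; [apply continuity_pt_const; now intros ? ?|apply Cz].
    - exists s; split; [exact Hs|lra]. }
  set (s := fun c => proj1_sig (constructive_indefinite_description _ (Hex c))).
  assert (Hs : forall c, t0 <= s c <= t1 /\ z (s c) = clamp (z t1) (z t0) c)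
    by (intros c; exact (proj2_sig (constructive_indefinite_description _ (Hex c)))).
  clearbody s; exists s.
  assert (Hinj : forall u v, t0 <= u <= t1 -> t0 <= v <= t1 -> z u = z v -> u = v).
  { intros u v Hu Hv E; destruct (Rtotal_order u v) as [H|[H|H]]; [|exact H|].
    - assert (z v < z u) by (apply Hdec; lra); lra.
    - assert (z u < z v) by (apply Hdec; lra); lra. }
  split; [|split].
  - intros c e He; destruct (Hs c) as [Hc Ec].
    (* By monotonicity, moving at least [e] away from [s c] changes [z] by at least [d1] or [d2].
       The value 1 is a dummy for the case that the displaced point leaves the interval. *)
    assert (D1 : exists d, 0 < d /\
      forall v, t0 <= v <= t1 -> s c + e <= v -> d <= z (s c) - z v).
    { destruct (Rle_dec (s c + e) t1) as [Hl|Hl].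
      - exists (z (s c) - z (s c + e)); split.
        + assert (z (s c + e) < z (s c)) by (apply Hdec; lra); lra.
        + intros v Hv [Hv'|<-]; [|lra].
          assert (z v < z (s c + e)) by (apply Hdec; lra); lra.
      - exists 1; split; [lra|intros; lra]. }
    assert (D2 : exists d, 0 < d /\
      forall v, t0 <= v <= t1 -> v <= s c - e -> d <= z v - z (s c)).
    { destruct (Rle_dec t0 (s c - e)) as [Hl|Hl].
      - exists (z (s c - e) - z (s c)); split.
        + assert (z (s c) < z (s c - e)) by (apply Hdec; lra); lra.
        + intros v Hv [Hv'|E]; [|subst v; lra].
          assert (z (s c - e) < z v) by (apply Hdec; lra); lra.
      - exists 1; split; [lra|intros; lra]. }
    destruct D1 as [d1 [Hd1 K1]]; destruct D2 as [d2 [Hd2 K2]].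
    exists (Rmin d1 d2); split; [apply Rmin_glb_lt; lra|].
    intros k [_ Hk]; unfold dist in *; simpl in *; unfold R_dist in *.
    destruct (Hs k) as [Hk1 Ek].
    assert (Hl := clamp_lipschitz (z t1) (z t0) k c (Rlt_le _ _ Hz10)).
    rewrite <- Ek, <- Ec in Hl.
    assert (Rmin d1 d2 <= d1) by apply Rmin_l.
    assert (Rmin d1 d2 <= d2) by apply Rmin_r.
    assert (Hd : Rabs (z (s k) - z (s c)) < Rmin d1 d2) by lra.
    apply Rabs_def2 in Hd.
    apply Rabs_def1.
    + destruct (Rlt_dec (s k - s c) e) as [|Hn]; [assumption|].
      specialize (K1 (s k) Hk1); lra.
    + destruct (Rlt_dec (- e) (s k - s c)) as [|Hn]; [assumption|].
      specialize (K2 (s k) Hk1); lra.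
  - intros t Ht; destruct (Hs (z t)) as [H1 H2]; apply Hinj; auto.
    rewrite H2; apply clamp_id; split.
    + destruct (Req_dec t t1) as [->|]; [lra|left; apply Hdec; lra].
    + destruct (Req_dec t t0) as [->|]; [lra|left; apply Hdec; lra].
  - intros c Hc; destruct (Hs c) as [H1 H2].
    rewrite clamp_id in H2 by lra; split; [|exact H2].
    split.
    + destruct (Req_dec (s c) t0) as [E|]; [rewrite E in H2; lra|lra].
    + destruct (Req_dec (s c) t1) as [E|]; [rewrite E in H2; lra|lra].
Qed.

Lemma lipschitz_continuity (L : R) (g : R -> R) (u : R) :
  lipschitz L g -> continuity_pt g u.
Proof.
  intros [HL Hg] e He; exists (e / (L + 1)); split.
  - apply Rdiv_lt_0_compat; lra.
  - intros v [_ Hv]; unfold dist in *; simpl in *; unfold R_dist in *.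
    eapply Rle_lt_trans; [apply Hg|].
    assert (0 <= Rabs (v - u)) by apply Rabs_pos.
    apply Rle_lt_trans with ((L + 1) * Rabs (v - u)); [nra|].
    apply (Rmult_lt_compat_l (L + 1)) in Hv; [|lra].
    replace ((L + 1) * (e / (L + 1))) with e in Hv by (field; lra); exact Hv.
Qed.

(** Since u' = h z', a quotient of increments of [u] and [z] is a value of [h] at an intermediate
    time, and this tends to [h (s c)] by continuity of [s] and [h]. *)
Lemma is_derive_reparam (u z s h dz : R -> R) (c e : R) :
  0 < e ->
  (forall t, is_derive z t (dz t)) -> (forall t, is_derive u t (h t * dz t)) ->
  continuity_pt s c -> continuity_pt h (s c) ->
  (forall k, Rabs (k - c) < e -> z (s k) = k) ->
  (forall k t, Rabs (k - c) < e -> Rmin (s c) (s k) < t < Rmax (s c) (s k) -> dz t <> 0) ->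
  is_derive (fun k => u (s k)) c (h (s c)).
Proof.
  intros He Hz Hu Hs Hh Hzs Hdz; apply is_derive_Reals; intros eps Heps.
  destruct (Hh eps Heps) as [d1 [Hd1 K1]].
  destruct (Hs d1 Hd1) as [d2 [Hd2 K2]].
  assert (Hd : 0 < Rmin e d2) by (apply Rmin_glb_lt; lra).
  exists (mkposreal _ Hd); simpl; intros k Hk0 Hk.
  assert (Hke : Rabs (c + k - c) < e).
  { replace (c + k - c) with k by ring; generalize (Rmin_l e d2); lra. }
  assert (Hzc : z (s c) = c).
  { apply Hzs; rewrite Rminus_diag, Rabs_R0; lra. }
  assert (Hzk := Hzs _ Hke).
  assert (Hsk : Rabs (s (c + k) - s c) < d1).
  { apply (K2 (c + k)); split; [split; [exact I|lra]|].
    unfold dist; simpl; unfold R_dist.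
    replace (c + k - c) with k by ring; generalize (Rmin_r e d2); lra. }
  (* Cauchy's mean value theorem for [u] and [z]. *)
  assert (Hx : exists t, Rmin (s c) (s (c + k)) < t < Rmax (s c) (s (c + k)) /\
                         u (s (c + k)) - u (s c) = h t * k).
  { set (p := Rmin (s c) (s (c + k))); set (q := Rmax (s c) (s (c + k))).
    assert (Hpq : p < q).
    { assert (s c <> s (c + k)) by (intros E; rewrite <- E in Hzk; lra).
      unfold p, q, Rmin, Rmax; destruct Rle_dec; lra. }
    destruct (mean_value_open
       (fun t => (u (s (c + k)) - u (s c)) * z t - k * u t)
       (fun t => (u (s (c + k)) - u (s c)) * dz t - k * (h t * dz t)) p q Hpq)
      as [t [Ht E]].
    - intros t _; apply is_derive_continuity_pt with
        ((u (s (c + k)) - u (s c)) * dz t - k * (h t * dz t)).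
      auto_derive; [repeat split; eexists; eauto|].
      rewrite_derive Hz; rewrite_derive Hu; ring.
    - intros t _; auto_derive; [repeat split; eexists; eauto|].
      rewrite_derive Hz; rewrite_derive Hu; ring.
    - exists t; split; [exact Ht|].
      assert (E' : 0 = ((u (s (c + k)) - u (s c)) - h t * k) * dz t * (q - p)).
      (* The auxiliary function takes equal values at the two times, whichever of them comes
         first. *)
      { assert (E0 : forall a b, (a = s c /\ b = s (c + k)) \/ (b = s c /\ a = s (c + k)) ->
          (u (s (c + k)) - u (s c)) * z b - k * u b -
          ((u (s (c + k)) - u (s c)) * z a - k * u a) = 0).
        { intros a b [[-> ->]|[-> ->]]; rewrite Hzc, Hzk; ring. }
        rewrite E0 in E; [rewrite E; ring|].
        unfold p, q, Rmin, Rmax; destruct Rle_dec; auto. }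
      assert (Hn : dz t <> 0) by (apply (Hdz (c + k)); auto).
      symmetry in E'; apply Rmult_integral in E'; destruct E' as [E'|]; [|lra].
      apply Rmult_integral in E'; destruct E' as [|]; [lra|contradiction]. }
  destruct Hx as [t [Ht ->]].
  replace (h t * k / k) with (h t) by (field; auto).
  destruct (Req_dec (s c) t) as [<-|Hne]; [rewrite Rminus_diag, Rabs_R0; lra|].
  apply (K1 t); split; [split; [exact I|exact Hne]|].
  unfold dist; simpl; unfold R_dist; apply Rabs_def2 in Hsk.
  revert Ht; unfold Rmin, Rmax; destruct Rle_dec; intros; apply Rabs_def1; lra.
Qed.

(** From u = x^2/2 follows u' = x (z + g(x)), and z' = -x, so du/dz = -(z + g(x)). Using the square
    avoids the division by x that dx/dz would bring at the ends of the arc. *)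
Lemma right_arc_graph (L : R) (g x z : R -> R) (t0 t1 : R) :
  lipschitz L g -> lienard g x z -> t0 < t1 -> (forall t, t0 < t < t1 -> 0 < x t) ->
  exists U : R -> R,
    (forall c, continuity_pt U c) /\
    (forall t, t0 <= t <= t1 -> U (z t) = x t ^ 2 / 2) /\
    (forall c, z t1 < c < z t0 -> exists t,
       0 < x t /\ U c = x t ^ 2 / 2 /\ is_derive U c (- (c + g (x t)))).
Proof.
  intros Hg Hs H01 Hpos.
  destruct (lienard_continuity g x z Hs) as [Cx Cz]; destruct Hs as [Hx Hz].
  destruct (decreasing_inverse z (fun t => - x t) t0 t1) as [s [Cs [Hs1 Hs2]]]; auto.
  { intros t Ht; specialize (Hpos t Ht); lra. }
  set (u := fun t => x t ^ 2 / 2).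
  set (h := fun t => - (z t + g (x t))).
  assert (Hu : forall t, is_derive u t (h t * - x t)).
  { intros t; unfold u, h; auto_derive; [repeat split; eexists; eauto|].
    rewrite_derive Hx; field. }
  exists (fun c => u (s c)); split; [|split].
  - intros c; apply (continuity_pt_comp s u); [apply Cs|].
    eapply is_derive_continuity_pt; apply Hu.
  - intros t Ht; now rewrite Hs1.
  - intros c Hc; destruct (Hs2 c Hc) as [H1 H2].
    exists (s c); split; [auto|split; [reflexivity|]].
    replace (- (c + g (x (s c)))) with (h (s c)) by (unfold h; now rewrite H2).
    assert (He : 0 < Rmin (c - z t1) (z t0 - c)) by (apply Rmin_glb_lt; lra).
    assert (Hn : forall k, Rabs (k - c) < Rmin (c - z t1) (z t0 - c) -> z t1 < k < z t0).
    { intros k Hk; apply Rabs_def2 in Hk.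
      generalize (Rmin_l (c - z t1) (z t0 - c)) (Rmin_r (c - z t1) (z t0 - c)); lra. }
    apply (is_derive_reparam u z s h (fun t => - x t) c _ He); auto.
    + unfold h; apply continuity_pt_opp, continuity_pt_plus; [apply Cz|].
      apply (continuity_pt_comp x g); [apply Cx|eapply lipschitz_continuity; eauto].
    + intros k Hk; apply Hs2; auto.
    + intros k t Hk Ht; destruct (Hs2 k (Hn k Hk)) as [H3 _].
      assert (0 < x t); [|lra].
      apply Hpos; revert Ht; unfold Rmin, Rmax; destruct Rle_dec; lra.
Qed.

(** * Comparison of the two halves of a periodic orbit *)

(** First D <= 0: wherever D > 0 the function D exp(-K c) decreases, so it has no positive maximum
    on an interval at whose left end it vanishes. Then D' < -K D, and D exp(K c) decreases strictly
    from zero. *)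
Lemma differential_inequality_neg (D : R -> R) (K a b : R) :
  a < b -> 0 <= K -> (forall c, continuity_pt D c) -> D a = 0 ->
  (forall c, a < c < b -> exists d, is_derive D c d /\ d < K * Rabs (D c)) ->
  D b < 0.
Proof.
  intros Hab HK CD Ha Hd.
  (* Stated for every [c] so that a derivative function can be chosen; 0 is a dummy value outside
     (a, b). *)
  assert (Hd' : forall c, exists d, a < c < b -> is_derive D c d /\ d < K * Rabs (D c)).
  { intros c; destruct (classic (a < c < b)) as [H|H].
    - destruct (Hd c H) as [d Hdd]; now exists d.
    - exists 0; intros; contradiction. }
  set (d := fun c => proj1_sig (constructive_indefinite_description _ (Hd' c))).
  assert (H : forall c, a < c < b -> is_derive D c (d c) /\ d c < K * Rabs (D c))
    by (intros c; exact (proj2_sig (constructive_indefinite_description _ (Hd' c)))).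
  clearbody d.
  assert (Hw : forall k, let f := fun c => D c * exp (k * c) in
    (forall c, continuity_pt f c) /\
    (forall c, a < c < b -> is_derive f c ((d c + k * D c) * exp (k * c)))).
  { intros k f; split; intros c.
    - apply continuity_pt_mult; [apply CD|].
      apply is_derive_continuity_pt with (k * exp (k * c)); auto_derive; [auto|ring].
    - intros Hc; destruct (H c Hc) as [H1 _]; unfold f.
      auto_derive; [repeat split; eexists; exact H1|].
      match goal with |- context [Derive ?f c] =>
        rewrite (is_derive_unique f c _ H1) end; ring. }
  assert (Hle : forall c, a <= c <= b -> D c <= 0).
  { destruct (Hw (- K)) as [Cf Df]; set (f := fun c => D c * exp (- K * c)) in *.
    destruct (continuity_ab_maj f a b) as [m [Hm1 Hm2]]; [lra|auto|].
    destruct (Rle_dec (D m) 0) as [Hm|Hm].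
    - intros c Hc; specialize (Hm1 c Hc); unfold f in Hm1.
      assert (0 < exp (- K * c)) by apply exp_pos.
      assert (0 < exp (- K * m)) by apply exp_pos.
      destruct (Rle_dec (D c) 0) as [|Hn]; [assumption|nra].
    - exfalso.
      assert (Hmp : 0 < D m) by lra.
      destruct (continuity_pt_pos_nbhd D m (CD m) Hmp) as [e [He Hpos]].
      assert (Ham : a < m) by (destruct (Req_dec a m) as [E|]; [rewrite <- E in Hmp; lra|lra]).
      set (q := Rmax a (m - e)).
      assert (Hqm : q < m) by (apply Rmax_lub_lt; lra).
      assert (a <= q) by apply Rmax_l.
      assert (m - e <= q) by apply Rmax_r.
      destruct (mean_value_open f (fun c => (d c + - K * D c) * exp (- K * c)) q m Hqm)
        as [c [Hc E]]; [auto|intros; apply Df; lra|].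
      assert (Hdc : 0 < D c) by (apply Hpos, Rabs_def1; lra).
      destruct (H c) as [_ Hlt]; [lra|].
      rewrite Rabs_pos_eq in Hlt by lra.
      assert (0 < exp (- K * c)) by apply exp_pos.
      assert (0 < (K * D c - d c) * exp (- K * c) * (m - q))
        by (repeat apply Rmult_lt_0_compat; lra).
      specialize (Hm1 q); lra. }
  destruct (Hw K) as [Cf Df]; set (f := fun c => D c * exp (K * c)) in *.
  destruct (mean_value_open f (fun c => (d c + K * D c) * exp (K * c)) a b Hab)
    as [c [Hc E]]; auto.
  destruct (H c Hc) as [_ Hlt].
  assert (Hc0 : D c <= 0) by (apply Hle; lra).
  rewrite Rabs_left1 in Hlt by lra.
  assert (0 < exp (K * c)) by apply exp_pos.
  assert (0 < exp (K * b)) by apply exp_pos.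
  assert (f a = 0) by (unfold f; rewrite Ha; ring).
  assert (0 < (- K * D c - d c) * exp (K * c) * (b - a))
    by (repeat apply Rmult_lt_0_compat; lra).
  assert (Hfb : f b < 0) by lra.
  unfold f in Hfb; nra.
Qed.

(** The hypothesis on [g] merges a positive odd part and an even part that is Lipschitz in x^2 into
    one inequality between the right half at x = u and the left half at x = -v, the points compared
    at equal height. *)
Lemma no_cyclic_of_odd_part_pos (L K r : R) (g x z : R -> R) (T : R) :
  lipschitz L g -> g 0 = 0 -> 0 <= K ->
  (forall u v, 0 < u < r -> 0 < v < r -> - (K * Rabs (u ^ 2 - v ^ 2)) < g u - g (- v)) ->
  lienard g x z -> cyclic T x z -> (forall t, Rabs (x t) < r) -> False.
Proof.
  intros Hg H0 HK Hodd Hs Hc Hr.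
  destruct (cyclic_max L g x z T Hg H0 Hs Hc) as [t0 [Hx0 [Hz0 Hmax]]].
  destruct (cyclic_right_arc L g x z T t0 Hg H0 Hs Hc Hx0 Hz0)
    as [t1 [H01 [Hx1 [Hz1 Hpos1]]]].
  (* The left half is a right arc of the solution rotated by half a turn. *)
  destruct (cyclic_right_arc L (fun u => - g (- u)) (fun t => - x t) (fun t => - z t) T t1)
    as [t2 [H12 [Hx2 [Hz2 Hpos2]]]].
  { now apply lipschitz_opp. }
  { rewrite Ropp_0, H0; ring. }
  { now apply lienard_opp. }
  { now apply cyclic_opp. }
  { lra. }
  { lra. }
  destruct (right_arc_graph L g x z t0 t1 Hg Hs H01 Hpos1) as [U [CU [EU DU]]].
  (* For its graph the left half is reflected and run backwards, so that it descends through x > 0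
     from height [z t2] to [z t1]. *)
  destruct (right_arc_graph L (fun u => g (- u)) (fun t => - x (0 - t)) (fun t => z (0 - t))
    (- t2) (- t1)) as [V [CV [EV DV]]].
  { now apply lipschitz_reverse. }
  { now apply lienard_reverse. }
  { lra. }
  { intros t Ht; apply Hpos2; lra. }
  assert (EV1 := EV (- t1)); assert (EV2 := EV (- t2)).
  replace (0 - - t1) with t1 in * by ring; replace (0 - - t2) with t2 in * by ring.
  assert (EU1 := EU t1).
  assert (Hxt2 : x t2 = 0) by lra.
  rewrite Hx1 in EV1, EU1; rewrite Hxt2 in EV2.
  assert (Hm2 := Hmax t2).
  assert (HD : U (z t2) - V (z t2) < 0).
  (* At equal height D' = g(-v) - g(u), with u and v the distances of the two halves from the
     z-axis. The factor 2 offsets the halves in u^2/2 and v^2/2. *)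
  { apply (differential_inequality_neg (fun c => U c - V c) (2 * K) (z t1) (z t2)).
    - lra.
    - lra.
    - intros c; apply continuity_pt_minus; auto.
    - rewrite EU1, EV1 by lra; field.
    - intros c Hcc.
      destruct (DU c) as [s1 [P1 [E1 D1]]]; [lra|].
      destruct (DV c) as [s2 [P2 [E2 D2]]]; [lra|].
      eexists; split; [apply (is_derive_minus U V); eassumption|].
      assert (B1 := Hr s1); assert (B2 := Hr (0 - s2)).
      apply Rabs_def2 in B1; apply Rabs_def2 in B2.
      specialize (Hodd (x s1) (- x (0 - s2))).
      rewrite E1, E2.
      replace (2 * K * Rabs (x s1 ^ 2 / 2 - (- x (0 - s2)) ^ 2 / 2))
        with (K * Rabs (x s1 ^ 2 - (- x (0 - s2)) ^ 2)).
      + unfold minus, plus, opp; simpl; simpl in Hodd; lra.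
      + replace (x s1 ^ 2 / 2 - (- x (0 - s2)) ^ 2 / 2)
          with ((x s1 ^ 2 - (- x (0 - s2)) ^ 2) * / 2) by field.
        rewrite Rabs_mult, (Rabs_pos_eq (/ 2)) by lra; field. }
  rewrite EV2 in HD by lra.
  (* As [z t0] is maximal, the height [z t2] belongs to the right arc, where [U] is half a square;
     [V] vanishes at this height. *)
  assert (HU : 0 <= U (z t2)).
  { destruct (Req_dec (z t2) (z t0)) as [E|Hne].
    - rewrite E, EU by lra.
      assert (0 <= x t0 ^ 2) by apply pow2_ge_0; lra.
    - destruct (DU (z t2)) as [s [_ [E _]]]; [lra|].
      rewrite E; assert (0 <= x s ^ 2) by apply pow2_ge_0; lra. }
  lra.
Qed.

(** * Global existence by Picard iteration *)

Lemma is_derive_RInt_0 (f : R -> R) (t : R) :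
  (forall s, continuity_pt f s) -> is_derive (fun s => RInt f 0 s) t (f t).
Proof.
  intros Hf; apply (is_derive_RInt f (fun s => RInt f 0 s) 0 t).
  - apply filter_forall; intros s; apply (RInt_correct (V := R_CompleteNormedModule)).
    apply (ex_RInt_continuous (V := R_CompleteNormedModule)).
    intros r _; apply continuity_pt_filterlim, Hf.
  - apply continuity_pt_filterlim, Hf.
Qed.

(** Integration gains a factor 1/k in the norm weighted by exp(k |t|), which allows a contraction on
    the whole line at once. *)
Lemma primitive_exp_bound (F f : R -> R) (C k t : R) :
  0 <= C -> 0 < k -> F 0 = 0 -> (forall s, is_derive F s (f s)) ->
  (forall s, Rabs (f s) <= C * exp (k * Rabs s)) ->
  Rabs (F t) <= C / k * exp (k * Rabs t).
Proof.
  intros HC Hk; revert F f t.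
  assert (H : forall (F f : R -> R) t, 0 <= t -> F 0 = 0 -> (forall s, is_derive F s (f s)) ->
    (forall s, Rabs (f s) <= C * exp (k * Rabs s)) -> F t <= C / k * exp (k * t)).
  { intros F f t Ht F0 HF Hf.
    assert (HCk : 0 <= C / k) by (apply Rdiv_le_0_compat; lra).
    assert (E := derive_nonneg_le (fun s => C / k * exp (k * s) - F s)
      (fun s => C * exp (k * s) - f s) 0 t Ht).
    cbv beta in E; rewrite F0, Rmult_0_r, exp_0 in E.
    assert (C / k * 1 - 0 <= C / k * exp (k * t) - F t); [apply E|lra].
    - intros s _; auto_derive; [repeat split; eexists; apply HF|].
      rewrite_derive HF; field; lra.
    - intros s Hs; specialize (Hf s); rewrite (Rabs_pos_eq s) in Hf by lra.
      generalize (Rle_abs (f s)); lra. }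
  assert (H' : forall (F f : R -> R) t, 0 <= t -> F 0 = 0 -> (forall s, is_derive F s (f s)) ->
    (forall s, Rabs (f s) <= C * exp (k * Rabs s)) -> Rabs (F t) <= C / k * exp (k * t)).
  { intros F f t Ht F0 HF Hf; apply Rabs_le; split; [|now apply (H F f)].
    assert (- F t <= C / k * exp (k * t)); [|lra].
    apply (H (fun s => - F s) (fun s => - f s)); auto; [lra| |].
    - intros s; now apply (is_derive_opp F).
    - intros s; now rewrite Rabs_Ropp. }
  intros F f t F0 HF Hf; destruct (Rle_dec 0 t) as [Ht|Ht].
  - rewrite (Rabs_pos_eq t Ht); now apply (H' F f).
  - rewrite (Rabs_left t) by lra.
    replace (F t) with ((fun s => F (- s)) (- t)) by (simpl; f_equal; ring).
    apply (H' (fun s => F (- s)) (fun s => - f (- s))); [lra|now rewrite Ropp_0| |].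
    + intros s; auto_derive; [repeat split; eexists; apply HF|].
      rewrite_derive HF; ring.
    + intros s; rewrite Rabs_Ropp, <- (Rabs_Ropp s); apply Hf.
Qed.

Lemma pow_half_small (A e : R) :
  0 <= A -> 0 < e -> exists N, forall n, (N <= n)%nat -> A * (1 / 2) ^ n < e.
Proof.
  intros HA He.
  destruct (pow_lt_1_zero (1 / 2)) with (y := e / (A + 1)) as [N HN].
  { rewrite Rabs_pos_eq; lra. }
  { apply Rdiv_lt_0_compat; lra. }
  exists N; intros n Hn; specialize (HN n Hn).
  assert (Hp : 0 < (1 / 2) ^ n) by (apply pow_lt; lra).
  rewrite Rabs_pos_eq in HN by lra.
  apply (Rmult_lt_compat_l (A + 1)) in HN; [|lra].
  replace ((A + 1) * (e / (A + 1))) with e in HN by (field; lra); lra.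
Qed.

(** Telescoping bounds the differences by the tail of a geometric series. The rate is kept along
    with the limit, since locally uniform convergence is read off from it. *)
Lemma geometric_limit (u : nat -> R) (A : R) :
  (forall n, Rabs (u (S n) - u n) <= A * (1 / 2) ^ n) ->
  exists l, forall n, Rabs (u n - l) <= 2 * A * (1 / 2) ^ n.
Proof.
  intros Hu.
  assert (HA : 0 <= A).
  { specialize (Hu 0%nat); simpl in Hu.
    generalize (Rabs_pos (u 1%nat - u 0%nat)); lra. }
  assert (H : forall n m, Rabs (u (n + m)%nat - u n)
                          <= 2 * A * ((1 / 2) ^ n - (1 / 2) ^ (n + m))).
  { intros n m; induction m as [|m IH].
    - rewrite Nat.add_0_r, !Rminus_diag, Rabs_R0; lra.
    - rewrite Nat.add_succ_r; specialize (Hu (n + m)%nat).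
      replace (u (S (n + m)) - u n)
        with ((u (S (n + m)) - u (n + m)%nat) + (u (n + m)%nat - u n)) by ring.
      eapply Rle_trans; [apply Rabs_triang|]; simpl pow; lra. }
  assert (H' : forall n m, (n <= m)%nat -> Rabs (u m - u n) <= 2 * A * (1 / 2) ^ n).
  { intros n m Hnm; replace m with (n + (m - n))%nat by lia.
    eapply Rle_trans; [apply H|].
    assert (0 < (1 / 2) ^ (n + (m - n))) by (apply pow_lt; lra); nra. }
  destruct (Rcomplete.R_complete u) as [l Hl].
  { intros e He; destruct (pow_half_small (4 * A) e) as [N HN]; [lra|exact He|].
    exists N; intros n m Hn Hm; unfold Rdist; specialize (HN N (le_n N)).
    replace (u n - u m) with ((u n - u N) - (u m - u N)) by ring.
    eapply Rle_lt_trans; [apply Rabs_triang|]; rewrite Rabs_Ropp.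
    assert (A1 := H' N n Hn); assert (A2 := H' N m Hm); lra. }
  exists l; intros n; apply Rnot_gt_le; intros Hn.
  destruct (Hl (Rabs (u n - l) - 2 * A * (1 / 2) ^ n)) as [N HN]; [lra|].
  specialize (HN (n + N)%nat); unfold Rdist in HN.
  assert (HN' := HN ltac:(lia)); assert (A1 := H' n (n + N)%nat ltac:(lia)).
  assert (Rabs (u n - l) <= Rabs (u (n + N)%nat - l) + Rabs (u (n + N)%nat - u n)); [|lra].
  replace (u n - l) with ((u (n + N)%nat - l) + - (u (n + N)%nat - u n)) by ring.
  eapply Rle_trans; [apply Rabs_triang|]; rewrite Rabs_Ropp; lra.
Qed.

(** Within distance 1 of [t] the weight is at most exp(k (|t| + 1)), so convergence is uniform there
    and the three-term estimate applies. *)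
Lemma uniform_limit_continuity (X : nat -> R -> R) (Y : R -> R) (A k : R) :
  0 <= A -> 0 <= k -> (forall n t, continuity_pt (X n) t) ->
  (forall n t, Rabs (X n t - Y t) <= A * (1 / 2) ^ n * exp (k * Rabs t)) ->
  forall t, continuity_pt Y t.
Proof.
  intros HA Hk HX HXY t e He.
  set (B := A * exp (k * (Rabs t + 1))).
  assert (HB : 0 <= B) by (apply Rmult_le_pos; [lra|left; apply exp_pos]).
  destruct (pow_half_small B (e / 3) HB) as [N HN]; [lra|].
  specialize (HN N (le_n N)).
  assert (Hcl : forall s, Rabs (s - t) < 1 -> Rabs (X N s - Y s) < e / 3).
  { intros s Hs; eapply Rle_lt_trans; [apply HXY|].
    apply Rle_lt_trans with (2 := HN); unfold B.
    replace (A * exp (k * (Rabs t + 1)) * (1 / 2) ^ N)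
      with (A * (1 / 2) ^ N * exp (k * (Rabs t + 1))) by ring.
    apply Rmult_le_compat_l.
    - apply Rmult_le_pos; [lra|apply pow_le; lra].
    - assert (Rabs s <= Rabs t + 1).
      { replace s with ((s - t) + t) by ring.
        eapply Rle_trans; [apply Rabs_triang|]; lra. }
      destruct (Rle_lt_or_eq_dec (k * Rabs s) (k * (Rabs t + 1))) as [Hl|Hl];
        [apply Rmult_le_compat_l; lra | left; now apply exp_increasing | rewrite Hl; lra]. }
  destruct (HX N t (e / 3)) as [d [Hd Hc]]; [lra|].
  exists (Rmin d 1); split; [apply Rmin_glb_lt; lra|].
  intros s [Hne Hs]; unfold dist in *; simpl in *; unfold R_dist in *.
  assert (Rmin d 1 <= d) by apply Rmin_l; assert (Rmin d 1 <= 1) by apply Rmin_r.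
  assert (A1 := Hcl s ltac:(lra)).
  assert (A2 := Hcl t ltac:(rewrite Rminus_diag, Rabs_R0; lra)).
  assert (A3 := Hc s ltac:(split; [exact Hne|lra])).
  replace (Y s - Y t) with (- (X N s - Y s) + ((X N s - X N t) + (X N t - Y t))) by ring.
  eapply Rle_lt_trans; [apply Rabs_triang|]; rewrite Rabs_Ropp.
  assert (Rabs (X N s - X N t + (X N t - Y t)) <= Rabs (X N s - X N t) + Rabs (X N t - Y t))
    by apply Rabs_triang.
  lra.
Qed.

(** As z = a - int_0^t x, the system with x(0) = 0 and z(0) = a is a single integral equation for
    x. *)
Definition picard (g : R -> R) (a : R) (f : R -> R) (t : R) : R :=
  RInt (fun s => a - RInt f 0 s + g (f s)) 0 t.

Lemma picard_derive (L : R) (g f : R -> R) (a t : R) :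
  lipschitz L g -> (forall s, continuity_pt f s) ->
  is_derive (picard g a f) t (a - RInt f 0 t + g (f t)).
Proof.
  intros Hg Hf; apply (is_derive_RInt_0 (fun s => a - RInt f 0 s + g (f s))).
  intros s; apply continuity_pt_plus; [apply continuity_pt_minus|].
  - apply continuity_pt_const; now intros ? ?.
  - apply (is_derive_continuity_pt _ s (f s)), is_derive_RInt_0, Hf.
  - apply (continuity_pt_comp f g); [apply Hf|eapply lipschitz_continuity; eauto].
Qed.

(** The integrands differ by at most (L + 1/k) C times the weight, hence by (L + 1) C times it;
    integration divides by k = 2 (L + 1). *)
Lemma picard_contraction (L : R) (g f1 f2 : R -> R) (a C t : R) :
  lipschitz L g -> 0 <= C ->
  (forall s, continuity_pt f1 s) -> (forall s, continuity_pt f2 s) ->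
  (forall s, Rabs (f1 s - f2 s) <= C * exp (2 * (L + 1) * Rabs s)) ->
  Rabs (picard g a f1 t - picard g a f2 t) <= C / 2 * exp (2 * (L + 1) * Rabs t).
Proof.
  intros Hg HC C1 C2 H; assert (HL := proj1 Hg).
  set (k := 2 * (L + 1)) in *; assert (Hk : 2 <= k) by (unfold k; lra).
  assert (HJ : forall s, Rabs (RInt f1 0 s - RInt f2 0 s) <= C / k * exp (k * Rabs s)).
  { intros s; apply (primitive_exp_bound (fun r => RInt f1 0 r - RInt f2 0 r)
      (fun r => f1 r - f2 r)); auto; [lra| |].
    - rewrite !RInt_point; apply Rminus_diag.
    - intros r; apply (is_derive_minus (fun r => RInt f1 0 r) (fun r => RInt f2 0 r));
        now apply is_derive_RInt_0. }
  replace (C / 2) with (C * (L + 1) / k) by (unfold k; field; lra).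
  apply (primitive_exp_bound (fun r => picard g a f1 r - picard g a f2 r)
    (fun r => (a - RInt f1 0 r + g (f1 r)) - (a - RInt f2 0 r + g (f2 r)))).
  - apply Rmult_le_pos; lra.
  - lra.
  - unfold picard; rewrite !RInt_point; apply Rminus_diag.
  - intros r; apply (is_derive_minus (picard g a f1) (picard g a f2));
      now apply (picard_derive L).
  - intros s.
    replace (a - RInt f1 0 s + g (f1 s) - (a - RInt f2 0 s + g (f2 s)))
      with ((g (f1 s) - g (f2 s)) + - (RInt f1 0 s - RInt f2 0 s)) by ring.
    eapply Rle_trans; [apply Rabs_triang|]; rewrite Rabs_Ropp.
    assert (A1 := proj2 Hg (f1 s) (f2 s)); specialize (H s); specialize (HJ s).
    assert (L * Rabs (f1 s - f2 s) <= L * (C * exp (k * Rabs s)))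
      by (apply Rmult_le_compat_l; lra).
    assert (C / k <= C).
    { unfold Rdiv; rewrite <- (Rmult_1_r C) at 2; apply Rmult_le_compat_l; [lra|].
      rewrite <- Rinv_1; apply Rinv_le_contravar; lra. }
    assert (C / k * exp (k * Rabs s) <= C * exp (k * Rabs s))
      by (apply Rmult_le_compat_r; [left; apply exp_pos|lra]).
    lra.
Qed.

Lemma lienard_exists (L : R) (g : R -> R) (a : R) :
  lipschitz L g -> exists x z, lienard g x z /\ x 0 = 0 /\ z 0 = a.
Proof.
  intros Hg; assert (HL := proj1 Hg).
  set (k := 2 * (L + 1)); assert (Hk : 2 <= k) by (unfold k; lra).
  set (X := fun n => Nat.iter n (picard g a) (fun _ => 0)).
  assert (CX : forall n t, continuity_pt (X n) t).
  { intros n; induction n as [|n IH]; intros t.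
    - apply continuity_pt_const; now intros ? ?.
    - eapply is_derive_continuity_pt, (picard_derive L); auto. }
  (* The first iterate, starting from zero, integrates the constant [a + g 0]. *)
  set (C := Rabs (a + g 0)).
  assert (HC : 0 <= C) by apply Rabs_pos.
  assert (Hstep : forall n t,
    Rabs (X (S n) t - X n t) <= C * (1 / 2) ^ n * exp (k * Rabs t)).
  { intros n; induction n as [|n IH]; intros t.
    - simpl; rewrite Rminus_0_r, Rmult_1_r.
      apply Rle_trans with (C / k * exp (k * Rabs t)).
      + apply (primitive_exp_bound _ _ C k t HC ltac:(lra)
          (RInt_point _ _) (fun s => picard_derive L g (fun _ => 0) a s Hg (CX 0%nat))).
        intros s; rewrite RInt_const; unfold scal; simpl; unfold mult; simpl.
        rewrite Rmult_0_r, Rminus_0_r; fold C.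
        rewrite <- (Rmult_1_r C) at 1; apply Rmult_le_compat_l; [lra|].
        assert (0 <= k * Rabs s) by (apply Rmult_le_pos; [lra|apply Rabs_pos]).
        generalize (exp_ineq1_le (k * Rabs s)); lra.
      + apply Rmult_le_compat_r; [left; apply exp_pos|].
        unfold Rdiv; rewrite <- (Rmult_1_r C) at 2; apply Rmult_le_compat_l; [lra|].
        rewrite <- Rinv_1; apply Rinv_le_contravar; lra.
    - replace (C * (1 / 2) ^ S n) with (C * (1 / 2) ^ n / 2) by (simpl; field).
      apply (picard_contraction L g (X (S n)) (X n) a); auto.
      apply Rmult_le_pos; [lra|apply pow_le; lra]. }
  assert (Hlim : forall t, exists l, forall n,
    Rabs (X n t - l) <= 2 * C * (1 / 2) ^ n * exp (k * Rabs t)).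
  { intros t; destruct (geometric_limit (fun n => X n t) (C * exp (k * Rabs t))) as [l Hl].
    - intros n; specialize (Hstep n t); lra.
    - exists l; intros n; specialize (Hl n); lra. }
  set (Y := fun t => proj1_sig (constructive_indefinite_description _ (Hlim t))).
  assert (HY : forall n t, Rabs (X n t - Y t) <= 2 * C * (1 / 2) ^ n * exp (k * Rabs t))
    by (intros n t; exact (proj2_sig (constructive_indefinite_description _ (Hlim t)) n)).
  clearbody Y.
  assert (CY : forall t, continuity_pt Y t)
    by (apply (uniform_limit_continuity X Y (2 * C) k); auto; lra).
  (* Both sides are close to [X (S N) t], and the two distances add up to at most
     [B * (1 / 2) ^ N]. *)
  assert (Hfix : forall t, picard g a Y t = Y t).
  { intros t; apply Rminus_diag_uniq, Rabs_eq_0.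
    apply Rle_antisym; [|apply Rabs_pos].
    apply Rnot_gt_le; intros Hn.
    set (B := 2 * C * exp (k * Rabs t)).
    assert (HB : 0 <= B) by (apply Rmult_le_pos; [lra|left; apply exp_pos]).
    destruct (pow_half_small B _ HB Hn) as [N HN]; specialize (HN N (le_n N)).
    assert (A1 := HY (S N) t).
    assert (A2 := picard_contraction L g (X N) Y a (2 * C * (1 / 2) ^ N) t Hg).
    fold k in A2.
    assert (A3 : Rabs (picard g a (X N) t - picard g a Y t)
                 <= 2 * C * (1 / 2) ^ N / 2 * exp (k * Rabs t)).
    { apply A2; auto; apply Rmult_le_pos; [lra|apply pow_le; lra]. }
    change (picard g a (X N) t) with (X (S N) t) in A3.
    assert (Rabs (picard g a Y t - Y t)
      <= Rabs (X (S N) t - Y t) + Rabs (X (S N) t - picard g a Y t)).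
    { replace (picard g a Y t - Y t)
        with ((X (S N) t - Y t) + - (X (S N) t - picard g a Y t)) by ring.
      eapply Rle_trans; [apply Rabs_triang|]; rewrite Rabs_Ropp; lra. }
    unfold B in HN; simpl pow in A1; lra. }
  exists Y, (fun t => a - RInt Y 0 t); split; [split|split].
  - intros t; apply (is_derive_ext (picard g a Y)); [exact Hfix|].
    now apply (picard_derive L).
  - intros t; rewrite <- (Rminus_0_l (Y t)).
    apply (is_derive_minus (fun _ => a) (fun s => RInt Y 0 s));
      [apply (is_derive_const a)|now apply is_derive_RInt_0].
  - rewrite <- Hfix; unfold picard; now rewrite RInt_point.
  - rewrite RInt_point; apply Rminus_0_r.
Qed.

(** * Periodic neighbours in the reversible case *)

(* A reversible solution is odd-even about each time at which it meets the [z]-axis, so two such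
   times make it periodic. *)
Lemma reversible_nearby_cycle (L : R) (g x z : R -> R) (T delta : R) :
  lipschitz L g -> g 0 = 0 -> (forall u, g (- u) = g u) ->
  lienard g x z -> cyclic T x z -> 0 < delta ->
  exists x' z' T', lienard g x' z' /\ cyclic T' x' z' /\
    (forall t, exists s, Rabs (x' t - x s) < delta /\ Rabs (z' t - z s) < delta) /\
    x' 0 = 0 /\ (forall t, z t < z' 0).
Proof.
  intros Hg H0 Hev Hs Hc Hdelta; assert (HL := proj1 Hg).
  destruct (cyclic_max L g x z T Hg H0 Hs Hc) as [t0 [Hx0 [Hz0 Hmax]]].
  destruct (cyclic_right_arc L g x z T t0 Hg H0 Hs Hc Hx0 Hz0)
    as [t1 [H01 [Hx1 [Hz1 Hpos]]]].
  (* [x] crosses zero transversally at [t1], because [z t1 < 0], and is negative shortly after. *)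
  destruct (derive_pos_right (fun t => - x t) t1 (- z t1)) as [e [He Hneg]].
  { generalize (proj1 Hs t1); rewrite Hx1, H0, Rplus_0_r; intros.
    now apply (is_derive_opp x). }
  { lra. }
  { lra. }
  (* Times elapsed since the highest point at which [x] is positive and then negative; a solution
     within [eta] of the orbit has the same signs there. *)
  set (p := (t0 + t1) / 2 - t0); set (q := t1 + e / 2 - t0).
  assert (Hp : 0 < x (p + t0)) by (apply Hpos; unfold p; lra).
  assert (Hq : 0 < - x (q + t0)) by (apply Hneg; unfold q; lra).
  assert (Hpq : 0 < p < q) by (unfold p, q; lra).
  clearbody p q.
  set (eta := Rmin delta (Rmin (x (p + t0)) (- x (q + t0)))).
  assert (Heta : 0 < eta) by (repeat apply Rmin_glb_lt; lra).
  assert (E1 : eta <= delta) by apply Rmin_l.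
  assert (E2 : eta <= x (p + t0)) by (eapply Rle_trans; [apply Rmin_r|apply Rmin_l]).
  assert (E3 : eta <= - x (q + t0)) by (eapply Rle_trans; [apply Rmin_r|apply Rmin_r]).
  clearbody eta.
  (* Over a time [2 * q] the distance grows at most by the factor exp(2 L q), so it stays below
     [eta / 2]. The length [2 * q] covers the whole period [2 * tau] found below. *)
  set (h := eta / 2 * exp (- (2 * L * q))).
  assert (Hh : 0 < h) by (apply Rmult_lt_0_compat; [lra|apply exp_pos]).
  destruct (lienard_exists L g (z t0 + h) Hg) as [x' [z' [Hs' [Hx'0 Hz'0]]]].
  assert (Hshift := lienard_shift g x z t0 Hs).
  assert (Hclose : forall t, 0 <= t <= 2 * q ->
    Rabs (x' t - x (t + t0)) < eta /\ Rabs (z' t - z (t + t0)) < eta).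
  { intros t Ht.
    assert (Hd := gronwall_forward L g x' z' _ _ 0 t Hg Hs' Hshift (proj1 Ht)).
    unfold sqdist in Hd; rewrite Hx'0, Hz'0, !Rplus_0_l, Hx0 in Hd.
    assert (He2 : exp (2 * L * (t - 0)) <= exp (2 * L * q) ^ 2).
    { replace (exp (2 * L * q) ^ 2) with (exp (2 * L * q + 2 * L * q))
        by (rewrite exp_plus; ring).
      assert (2 * L * (t - 0) <= 2 * L * q + 2 * L * q) by nra.
      destruct (Rle_lt_or_eq_dec _ _ H) as [Hl|Hl];
        [left; now apply exp_increasing | rewrite Hl; lra]. }
    assert (Hh2 : h * exp (2 * L * q) = eta / 2).
    { unfold h; rewrite Rmult_assoc, <- exp_plus.
      replace (- (2 * L * q) + 2 * L * q) with 0 by ring; rewrite exp_0; ring. }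
    assert (Hd2 : (x' t - x (t + t0)) ^ 2 + (z' t - z (t + t0)) ^ 2 <= (eta / 2) ^ 2).
    { eapply Rle_trans; [exact Hd|]; rewrite <- Hh2, Rpow_mult_distr.
      replace ((0 - 0) ^ 2 + (z t0 + h - z t0) ^ 2) with (h ^ 2) by ring.
      apply Rmult_le_compat_l; [apply pow2_ge_0|exact He2]. }
    assert (Hsq : forall v, v ^ 2 <= (eta / 2) ^ 2 -> Rabs v < eta).
    { intros v Hv; apply Rle_lt_trans with (eta / 2); [|lra].
      rewrite <- (Rabs_pos_eq (eta / 2)) by lra.
      apply Rsqr_le_abs_0; unfold Rsqr; lra. }
    split; apply Hsq.
    - generalize (pow2_ge_0 (z' t - z (t + t0))); lra.
    - generalize (pow2_ge_0 (x' t - x (t + t0))); lra. }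
  assert (Hx'p : 0 < x' p).
  { destruct (Hclose p) as [A _]; [lra|]; apply Rabs_def2 in A; lra. }
  assert (Hx'q : x' q < 0).
  { destruct (Hclose q) as [A _]; [lra|]; apply Rabs_def2 in A; lra. }
  destruct (lienard_continuity g x' z' Hs') as [Cx' _].
  destruct (IVT (fun t => - x' t) p q) as [tau [Htau Etau]]; [|lra|lra|lra|].
  { intros t; apply continuity_pt_opp, Cx'. }
  (* The solution reflected about a time [s] with [x' s = 0] agrees with the original at [s], hence
     everywhere by uniqueness. *)
  assert (Hsym : forall s t, x' s = 0 -> x' (2 * s - t) = - x' t /\ z' (2 * s - t) = z' t).
  { intros s t Hxs.
    assert (Hr : lienard g (fun r => - x' (2 * s - r)) (fun r => z' (2 * s - r))).
    { destruct (lienard_reverse g x' z' (2 * s) Hs') as [A B]; split; [|exact B].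
      intros r; rewrite <- Hev; apply A. }
    destruct (lienard_unique L g x' z' _ _ s t Hg Hs' Hr) as [A B].
    - replace (2 * s - s) with s by ring; lra.
    - now replace (2 * s - s) with s by ring.
    - split; lra. }
  assert (Hper : forall t, x' (t + 2 * tau) = x' t /\ z' (t + 2 * tau) = z' t).
  { intros t.
    destruct (Hsym tau (- t)) as [A1 B1]; [lra|].
    destruct (Hsym 0 t Hx'0) as [A2 B2].
    replace (2 * 0 - t) with (- t) in A2, B2 by ring.
    replace (2 * tau - - t) with (t + 2 * tau) in A1, B1 by ring.
    split; lra. }
  exists x', z', (2 * tau); split; [exact Hs'|split; [|split; [|split]]].
  - split; [lra|split; [|split]]; try apply Hper.
    exists p; rewrite Hx'0; intros E; injection E; lra.
  - intros t; destruct (periodic_reduce (2 * tau) 0 t) as [s [Hss E]]; [lra|].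
    exists (s + t0).
    rewrite (E x' (fun r => proj1 (Hper r))), (E z' (fun r => proj2 (Hper r))).
    destruct (Hclose s); [lra|]; split; lra.
  - exact Hx'0.
  - intros t; rewrite Hz'0; specialize (Hmax t); lra.
Qed.

(** * The primitive of p and its even and odd parts *)

Lemma clamp_opp (M u : R) : 0 <= M -> clamp (- M) M (- u) = - clamp (- M) M u.
Proof.
  intros H; unfold clamp, Rmax, Rmin; repeat destruct Rle_dec; lra.
Qed.

Fixpoint prim (lam : nat -> R) (k : nat) (x : R) : R :=
  match k with
  | O => 0
  | S k' => prim lam k' x + lam (S k') / INR (S (S k')) * x ^ S (S k')
  end.

Lemma prim_derive (lam : nat -> R) (k : nat) (x : R) :
  is_derive (prim lam k) x (poly_p lam k x).
Proof.
  induction k as [|k IH].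
  - apply (is_derive_const 0).
  - apply (is_derive_plus (prim lam k)
      (fun x => lam (S k) / INR (S (S k)) * x ^ S (S k))); [exact IH|].
    remember (S (S k)) as m; auto_derive; [auto|].
    replace (pred m) with (S k) by lia; field; apply not_0_INR; lia.
Qed.

Lemma prim_0 (lam : nat -> R) (k : nat) : prim lam k 0 = 0.
Proof.
  induction k as [|k IH]; simpl; [reflexivity|]; rewrite IH; ring.
Qed.

Lemma pow_lipschitz_on (M : R) (n : nat) : 0 <= M ->
  exists C, 0 <= C /\ forall u v, Rabs u <= M -> Rabs v <= M ->
    Rabs (u ^ n - v ^ n) <= C * Rabs (u - v).
Proof.
  intros HM; induction n as [|n [C [HC H]]].
  - exists 0; split; [lra|]; intros; simpl; rewrite Rminus_diag, Rabs_R0; lra.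
  - exists (M * C + M ^ n); split.
    + apply Rplus_le_le_0_compat; [apply Rmult_le_pos; lra|now apply pow_le].
    + intros u v Hu Hv; simpl.
      replace (u * u ^ n - v * v ^ n) with (u * (u ^ n - v ^ n) + v ^ n * (u - v)) by ring.
      eapply Rle_trans; [apply Rabs_triang|]; rewrite !Rabs_mult, <- RPow_abs.
      specialize (H u v Hu Hv).
      assert (Rabs v ^ n <= M ^ n) by (apply pow_incr; split; [apply Rabs_pos|exact Hv]).
      assert (Rabs u * Rabs (u ^ n - v ^ n) <= M * (C * Rabs (u - v)))
        by (apply Rmult_le_compat; auto; apply Rabs_pos).
      assert (Rabs v ^ n * Rabs (u - v) <= M ^ n * Rabs (u - v))
        by (apply Rmult_le_compat_r; [apply Rabs_pos|assumption]).
      lra.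
Qed.

Lemma prim_lipschitz_on (lam : nat -> R) (k : nat) (M : R) : 0 <= M ->
  exists C, 0 <= C /\ forall u v, Rabs u <= M -> Rabs v <= M ->
    Rabs (prim lam k u - prim lam k v) <= C * Rabs (u - v).
Proof.
  intros HM; induction k as [|k [C [HC H]]].
  - exists 0; split; [lra|]; intros; simpl; rewrite Rminus_diag, Rabs_R0; lra.
  - destruct (pow_lipschitz_on M (S (S k)) HM) as [D [HD HP]].
    set (c := lam (S k) / INR (S (S k))).
    exists (C + Rabs c * D); split.
    + apply Rplus_le_le_0_compat; [lra|apply Rmult_le_pos; [apply Rabs_pos|lra]].
    + intros u v Hu Hv; cbn [prim]; fold c.
      replace (prim lam k u + c * u ^ S (S k) - (prim lam k v + c * v ^ S (S k)))
        with ((prim lam k u - prim lam k v) + c * (u ^ S (S k) - v ^ S (S k))) by ring.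
      eapply Rle_trans; [apply Rabs_triang|]; rewrite Rabs_mult.
      specialize (H u v Hu Hv); specialize (HP u v Hu Hv).
      assert (Rabs c * Rabs (u ^ S (S k) - v ^ S (S k)) <= Rabs c * (D * Rabs (u - v)))
        by (apply Rmult_le_compat_l; [apply Rabs_pos|exact HP]).
      lra.
Qed.

(** A polynomial is Lipschitz on [-M, M] and clamping does not increase distances; orbits within |x|
    <= M do not notice the truncation. *)
Lemma prim_clamp_lipschitz (lam : nat -> R) (k : nat) (M : R) : 0 <= M ->
  exists L, lipschitz L (fun u => prim lam k (clamp (- M) M u)).
Proof.
  intros HM; destruct (prim_lipschitz_on lam k M HM) as [C [HC H]].
  exists C; split; [exact HC|]; intros u v.
  assert (B : forall w, Rabs (clamp (- M) M w) <= M)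
    by (intros w; apply Rabs_le, clamp_bounds; lra).
  eapply Rle_trans; [apply H; apply B|].
  apply Rmult_le_compat_l; [exact HC|apply clamp_lipschitz; lra].
Qed.

(** The half [m] is exposed so that an even power can be rewritten as a power of u^2. *)
Lemma pow_opp_parity (n : nat) :
  (exists m, n = (2 * m)%nat /\ forall u, (- u) ^ n = u ^ n) \/
  (forall u, (- u) ^ n = - u ^ n).
Proof.
  destruct (Nat.Even_or_Odd n) as [[m ->]|[m ->]].
  - left; exists m; split; [reflexivity|]; intros u.
    rewrite !pow_mult; f_equal; ring.
  - right; intros u; rewrite Nat.add_1_r, <- !tech_pow_Rmult.
    rewrite !pow_mult; replace ((- u) ^ 2) with (u ^ 2) by ring; ring.
Qed.

(** Odd powers cancel, and even ones are powers of u^2, Lipschitz in u^2 on [0, 1]. *)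
Lemma prim_even_part (lam : nat -> R) (k : nat) :
  exists K, 0 <= K /\ forall u v, 0 <= u <= 1 -> 0 <= v <= 1 ->
    Rabs (prim lam k u + prim lam k (- u) - (prim lam k v + prim lam k (- v)))
    <= K * Rabs (u ^ 2 - v ^ 2).
Proof.
  induction k as [|k [K [HK H]]].
  - exists 0; split; [lra|]; intros; simpl.
    replace (0 + 0 - (0 + 0)) with 0 by ring; rewrite Rabs_R0; lra.
  - set (c := lam (S k) / INR (S (S k))).
    destruct (pow_opp_parity (S (S k))) as [[m [Em Hp]]|Hp].
    + destruct (pow_lipschitz_on 1 m ltac:(lra)) as [D [HD HL]].
      exists (K + 2 * Rabs c * D); split.
      * apply Rplus_le_le_0_compat; [lra|].
        apply Rmult_le_pos; [generalize (Rabs_pos c); lra|lra].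
      * intros u v Hu Hv; cbn [prim]; fold c; rewrite !Hp, Em, !pow_mult.
        replace (prim lam k u + c * (u ^ 2) ^ m + (prim lam k (- u) + c * (u ^ 2) ^ m) -
          (prim lam k v + c * (v ^ 2) ^ m + (prim lam k (- v) + c * (v ^ 2) ^ m)))
          with ((prim lam k u + prim lam k (- u) - (prim lam k v + prim lam k (- v)))
                + 2 * c * ((u ^ 2) ^ m - (v ^ 2) ^ m)) by ring.
        eapply Rle_trans; [apply Rabs_triang|].
        rewrite !Rabs_mult, (Rabs_pos_eq 2) by lra.
        specialize (H u v Hu Hv).
        assert (HL' := HL (u ^ 2) (v ^ 2)
          ltac:(rewrite Rabs_pos_eq; nra) ltac:(rewrite Rabs_pos_eq; nra)).
        assert (2 * Rabs c * Rabs ((u ^ 2) ^ m - (v ^ 2) ^ m)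
                <= 2 * Rabs c * (D * Rabs (u ^ 2 - v ^ 2)))
          by (apply Rmult_le_compat_l; [generalize (Rabs_pos c); lra|exact HL']).
        lra.
    + exists K; split; [exact HK|]; intros u v Hu Hv; cbn [prim]; fold c; rewrite !Hp.
      eapply Rle_trans; [|now apply (H u v)]; right; f_equal; ring.
Qed.

(** The lowest odd term c s^j leads. The bound on [j] ensures that each later odd term has degree at
    least j + 1, so that it is absorbed in the remainder for s <= 1. *)
Lemma prim_odd_part (lam : nat -> R) (k : nat) :
  (forall s, prim lam k (- s) = prim lam k s) \/
  exists c j C, c <> 0 /\ 0 <= C /\ (j <= S k)%nat /\ forall s, 0 <= s <= 1 ->
    Rabs (prim lam k s - prim lam k (- s) - c * s ^ j) <= C * s ^ S j.
Proof.
  induction k as [|k IH]; [now left|].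
  set (c' := lam (S k) / INR (S (S k))).
  destruct (pow_opp_parity (S (S k))) as [[m [_ Hp]]|Hp].
  - destruct IH as [H|[c [j [C [Hc [HC [Hj H]]]]]]].
    + left; intros s; cbn [prim]; rewrite Hp, H; reflexivity.
    + right; exists c, j, C; repeat split; [auto|auto|lia|]; intros s Hs.
      eapply Rle_trans; [|now apply H]; right; cbn [prim]; rewrite Hp; f_equal; ring.
  - destruct IH as [H|[c [j [C [Hc [HC [Hj H]]]]]]].
    + destruct (Req_dec c' 0) as [E|Hne].
      * left; intros s; cbn [prim]; fold c'; rewrite E, H; ring.
      * right; exists (2 * c'), (S (S k)), 0; repeat split; [lra|lra|lia|]; intros s Hs.
        cbn [prim]; fold c'; rewrite Hp, H.
        replace (prim lam k s + c' * s ^ S (S k) - (prim lam k s + c' * - s ^ S (S k)) -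
          2 * c' * s ^ S (S k)) with 0 by ring.
        rewrite Rabs_R0; lra.
    + right; exists c, j, (C + 2 * Rabs c'); repeat split; [auto| |lia|].
      * generalize (Rabs_pos c'); lra.
      * intros s Hs; cbn [prim]; fold c'; rewrite Hp.
        replace (prim lam k s + c' * s ^ S (S k) - (prim lam k (- s) + c' * - s ^ S (S k)) -
          c * s ^ j) with ((prim lam k s - prim lam k (- s) - c * s ^ j) + 2 * c' * s ^ S (S k))
          by ring.
        eapply Rle_trans; [apply Rabs_triang|].
        rewrite !Rabs_mult, (Rabs_pos_eq 2), (Rabs_pos_eq (s ^ S (S k)))
          by (try apply pow_le; lra).
        specialize (H s Hs).
        assert (s ^ S (S k) <= s ^ S j).
        { replace (S (S k)) with (S j + (S k - j))%nat by lia; rewrite pow_add.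
          rewrite <- (Rmult_1_r (s ^ S j)) at 2; apply Rmult_le_compat_l; [apply pow_le; lra|].
          rewrite <- (pow1 (S k - j)); apply pow_incr; lra. }
        assert (2 * Rabs c' * s ^ S (S k) <= 2 * Rabs c' * s ^ S j)
          by (apply Rmult_le_compat_l; [generalize (Rabs_pos c'); lra|assumption]).
        lra.
Qed.

(** With E and O the sum and difference of P(s) and P(-s), 2 (P(u) - P(-v)) = E(u) - E(v) + O(u) +
    O(v). Here O has the sign of its leading coefficient; the second alternative is the first for
    the reflected P. *)
Lemma prim_even_or_odd_part_signed (lam : nat -> R) (k : nat) :
  (forall s, prim lam k (- s) = prim lam k s) \/
  exists r K, 0 < r /\ 0 <= K /\
    ((forall u v, 0 < u < r -> 0 < v < r ->
        - (K * Rabs (u ^ 2 - v ^ 2)) < prim lam k u - prim lam k (- v)) \/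
     (forall u v, 0 < u < r -> 0 < v < r ->
        - (K * Rabs (u ^ 2 - v ^ 2)) < prim lam k (- u) - prim lam k v)).
Proof.
  destruct (prim_odd_part lam k) as [H|[c [j [C [Hc [HC [_ H]]]]]]]; [now left|right].
  destruct (prim_even_part lam k) as [K [HK HE]].
  (* For s below |c| / (C + 1) the leading term exceeds the remainder; the estimates of both parts
     hold up to 1. *)
  set (r := Rmin 1 (Rabs c / (C + 1))).
  assert (Hcp := Rabs_pos_lt c Hc).
  assert (Hr : 0 < r) by (apply Rmin_glb_lt; [lra|apply Rdiv_lt_0_compat; lra]).
  assert (Hr1 : r <= 1) by apply Rmin_l.
  assert (Hrc : r * (C + 1) <= Rabs c).
  { replace (Rabs c) with (Rabs c / (C + 1) * (C + 1)) by (field; lra).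
    apply Rmult_le_compat_r; [lra|apply Rmin_r]. }
  assert (Hdom : forall s, 0 < s < r -> C * s ^ S j < Rabs c * s ^ j).
  { intros s Hs; simpl pow; assert (0 < s ^ j) by (apply pow_lt; lra).
    rewrite <- Rmult_assoc; apply Rmult_lt_compat_r; [assumption|nra]. }
  exists r, K; split; [exact Hr|split; [exact HK|]].
  assert (HE' : forall u v, 0 < u < r -> 0 < v < r ->
    - (K * Rabs (u ^ 2 - v ^ 2)) <=
      prim lam k u + prim lam k (- u) - (prim lam k v + prim lam k (- v))).
  { intros u v Hu Hv; specialize (HE u v ltac:(lra) ltac:(lra)).
    apply Rabs_le_between in HE; lra. }
  assert (Hpos : forall u v, 0 <= K * Rabs (u ^ 2 - v ^ 2))
    by (intros; apply Rmult_le_pos; [lra|apply Rabs_pos]).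
  destruct (Rlt_dec 0 c) as [Hcs|Hcs].
  - left; intros u v Hu Hv.
    assert (Ho : forall s, 0 < s < r -> 0 < prim lam k s - prim lam k (- s)).
    { intros s Hs; specialize (Hdom s Hs); rewrite Rabs_pos_eq in Hdom by lra.
      specialize (H s ltac:(lra)); apply Rabs_le_between in H; lra. }
    specialize (HE' u v Hu Hv); specialize (Hpos u v).
    assert (A1 := Ho u Hu); assert (A2 := Ho v Hv); lra.
  - right; intros u v Hu Hv.
    assert (Ho : forall s, 0 < s < r -> 0 < prim lam k (- s) - prim lam k s).
    { intros s Hs; specialize (Hdom s Hs); rewrite Rabs_left in Hdom by lra.
      specialize (H s ltac:(lra)); apply Rabs_le_between in H; lra. }
    specialize (HE' u v Hu Hv); specialize (Hpos u v).
    assert (A1 := Ho u Hu); assert (A2 := Ho v Hv); lra.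
Qed.

(** * Passage between the given system and Lienard coordinates *)

(** As x' = y, the term p(x) y in y' is the derivative of P(x) along the solution and cancels in z'
    for z = y - P(x). *)
Lemma is_solution_lienard (d : nat) (lam : nat -> R) (M : R) (x y : R -> R) :
  is_solution d lam x y -> (forall t, - M <= x t <= M) ->
  lienard (fun u => prim lam d (clamp (- M) M u)) x (fun t => y t - prim lam d (x t)).
Proof.
  intros [Hx Hy] HM; split; intros t.
  - rewrite clamp_id by apply HM.
    replace (y t - prim lam d (x t) + prim lam d (x t)) with (y t) by ring; apply Hx.
  - replace (- x t) with ((- x t + poly_p lam d (x t) * y t) - y t * poly_p lam d (x t)) by ring.
    apply (is_derive_minus y (fun s => prim lam d (x s))); [apply Hy|].
    apply (is_derive_comp (prim lam d) x); [apply prim_derive|apply Hx].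
Qed.

Lemma lienard_is_solution (d : nat) (lam : nat -> R) (M : R) (x z : R -> R) :
  lienard (fun u => prim lam d (clamp (- M) M u)) x z -> (forall t, - M <= x t <= M) ->
  is_solution d lam x (fun t => z t + prim lam d (x t)).
Proof.
  intros [Hx Hz] HM.
  assert (Hx' : forall t, is_derive x t (z t + prim lam d (x t))).
  { intros t; generalize (Hx t); now rewrite clamp_id by apply HM. }
  split; [exact Hx'|]; intros t.
  rewrite (Rmult_comm (poly_p lam d (x t))).
  apply (is_derive_plus z (fun s => prim lam d (x s))); [apply Hz|].
  apply (is_derive_comp (prim lam d) x); [apply prim_derive|apply Hx'].
Qed.

Lemma solution_cyclic (d : nat) (lam : nat -> R) (T : R) (x y : R -> R) :
  0 < T -> (forall t, x (t + T) = x t /\ y (t + T) = y t) ->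
  (exists t, (x t, y t) <> (x 0, y 0)) ->
  cyclic T x (fun t => y t - prim lam d (x t)).
Proof.
  intros HT Hp [t Hne]; split; [exact HT|split; [apply Hp|split]].
  - intros s; destruct (Hp s) as [-> ->]; reflexivity.
  - exists t; intros E; apply Hne; injection E; intros E2 E1.
    rewrite E1 in *; f_equal; lra.
Qed.

(** * Bounds and tubes for periodic orbits *)

Lemma periodic_bounded (f : R -> R) (T : R) :
  0 < T -> (forall t, continuity_pt f t) -> (forall t, f (t + T) = f t) ->
  exists M, forall t, Rabs (f t) <= M.
Proof.
  intros HT Cf Hp.
  destruct (continuity_ab_maj (fun t => Rabs (f t)) 0 T) as [m [Hm _]]; [lra| |].
  - intros t _; apply (continuity_pt_comp f Rabs); [apply Cf|apply Rcontinuity_abs].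
  - exists (Rabs (f m)); intros t; destruct (periodic_reduce T 0 t HT) as [s [Hs E]].
    rewrite (E f Hp); apply Hm; lra.
Qed.

(** Each point of the orbit has a radius of its own inside [V]; compactness of one period makes it
    uniform. *)
Lemma periodic_orbit_tube (V : pset) (x y : R -> R) (T : R) :
  0 < T -> (forall t, continuity_pt x t) -> (forall t, continuity_pt y t) ->
  (forall t, x (t + T) = x t) -> (forall t, y (t + T) = y t) ->
  Defs.open_set V -> (forall t, V (x t, y t)) ->
  exists e, 0 < e /\
    forall t u v, Rabs (u - x t) < e -> Rabs (v - y t) < e -> V (u, v).
Proof.
  intros HT Cx Cy Hpx Hpy HV Hin.
  assert (Hloc : forall t, exists e : posreal, forall s u v,
    Rabs (s - t) < e -> Rabs (u - x s) < e -> Rabs (v - y s) < e -> V (u, v)).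
  { intros t; destruct (HV _ (Hin t)) as [e [He HB]].
    assert (Hcl : forall f, continuity_pt f t ->
      exists d, 0 < d /\ forall s, Rabs (s - t) < d -> Rabs (f s - f t) < e / 4).
    { intros f Cf; destruct (Cf (e / 4)) as [d [Hd H]]; [lra|].
      exists d; split; [exact Hd|]; intros s Hs.
      destruct (Req_dec t s) as [<-|Hne]; [rewrite Rminus_diag, Rabs_R0; lra|].
      exact (H s (conj (conj I Hne) Hs)). }
    destruct (Hcl x (Cx t)) as [d1 [Hd1 K1]]; destruct (Hcl y (Cy t)) as [d2 [Hd2 K2]].
    (* Two displacements below e/4 move each coordinate by at most e/2, hence the squared distance
       is at most e^2/2. *)
    assert (Hd : 0 < Rmin (e / 4) (Rmin d1 d2)) by (repeat apply Rmin_glb_lt; lra).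
    exists (mkposreal _ Hd); simpl; intros s u v Hs Hu Hv.
    assert (M1 := Rmin_l (e / 4) (Rmin d1 d2)); assert (M2 := Rmin_r (e / 4) (Rmin d1 d2)).
    assert (M3 := Rmin_l d1 d2); assert (M4 := Rmin_r d1 d2).
    assert (A1 := K1 s ltac:(lra)); assert (A2 := K2 s ltac:(lra)).
    apply HB; unfold dist2; simpl fst; simpl snd.
    assert (B : forall a b c, Rabs (a - b) < e / 4 -> Rabs (c - a) < e / 4 ->
      (b - c) ^ 2 <= (e / 2) ^ 2).
    { intros a b c Ha Hb; apply Rabs_def2 in Ha; apply Rabs_def2 in Hb; nra. }
    assert (B1 := B (x s) (x t) u A1 ltac:(lra)).
    assert (B2 := B (y s) (y t) v A2 ltac:(lra)).
    nra. }
  set (dl := fun t => proj1_sig (constructive_indefinite_description _ (Hloc t))).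
  assert (Hdl : forall t s u v,
    Rabs (s - t) < dl t -> Rabs (u - x s) < dl t -> Rabs (v - y s) < dl t -> V (u, v))
    by (intros t; exact (proj2_sig (constructive_indefinite_description _ (Hloc t)))).
  clearbody dl.
  destruct (compactness_value_1d 0 T dl) as [e He].
  exists e; split; [apply cond_pos|]; intros t u v Hu Hv.
  destruct (periodic_reduce T 0 t HT) as [s [Hs E]].
  rewrite (E x Hpx) in Hu; rewrite (E y Hpy) in Hv.
  destruct (NNPP _ (He s ltac:(lra))) as [q [_ [Hq1 Hq2]]].
  apply (Hdl q s); lra.
Qed.

(** * Absence of limit cycles near the origin *)

Lemma solution_continuity (d : nat) (lam : nat -> R) (x y : R -> R) :
  is_solution d lam x y -> (forall t, continuity_pt x t) /\ (forall t, continuity_pt y t).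
Proof.
  intros [Hx Hy]; split; intros t; eapply is_derive_continuity_pt; eauto.
Qed.

(** The reversible neighbour of the orbit lies in a tube inside [V]. Isolation would identify it
    with [G], but its starting point has larger z than all points of [G]. *)
Lemma no_limit_cycle_of_even (d : nat) (lam : nat -> R) (G : pset) :
  (forall s, prim lam d (- s) = prim lam d s) -> ~ limit_cycle d lam G.
Proof.
  intros Hev [[x [y [T [Hs [HT [Hp [Hne HG]]]]]]] [V [HV [HGV Hiso]]]].
  destruct (solution_continuity d lam x y Hs) as [Cx Cy].
  assert (Hpx : forall t, x (t + T) = x t) by apply Hp.
  assert (Hpy : forall t, y (t + T) = y t) by apply Hp.
  destruct (periodic_bounded x T HT Cx Hpx) as [M0 HM0].
  assert (HM0p : 0 <= M0) by (eapply Rle_trans; [apply Rabs_pos|apply (HM0 0)]).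
  destruct (periodic_orbit_tube V x y T HT Cx Cy Hpx Hpy HV) as [e [He Htube]].
  { intros t; apply HGV, HG; now exists t. }
  (* The margin 1 leaves room for the neighbour, whose [x] differs by less than [dl <= 1]. *)
  set (M := M0 + 1).
  assert (HM : 0 <= M) by (unfold M; lra).
  destruct (prim_clamp_lipschitz lam d M HM) as [L HL].
  set (g := fun u => prim lam d (clamp (- M) M u)) in *.
  assert (Hg0 : g 0 = 0) by (unfold g; rewrite clamp_id by lra; apply prim_0).
  assert (Hgev : forall u, g (- u) = g u)
    by (intros u; unfold g; rewrite clamp_opp by exact HM; apply Hev).
  assert (Hxb : forall t, - M <= x t <= M)
    by (intros t; specialize (HM0 t); apply Rabs_le_between in HM0; unfold M; lra).
  assert (HLp := proj1 HL).
  (* Back in the coordinate y = z + P(x) a deviation [dl] becomes at most [(L + 1) * dl], which is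
     below [e]. *)
  set (dl := Rmin 1 (e / (L + 2))).
  assert (Hdl : 0 < dl) by (apply Rmin_glb_lt; [lra|apply Rdiv_lt_0_compat; lra]).
  assert (Hdl1 : dl <= 1) by apply Rmin_l.
  assert (Hdle : dl * (L + 2) <= e).
  { replace e with (e / (L + 2) * (L + 2)) by (field; lra).
    apply Rmult_le_compat_r; [lra|apply Rmin_r]. }
  destruct (reversible_nearby_cycle L g x (fun t => y t - prim lam d (x t)) T dl HL Hg0 Hgev)
    as [x' [z' [T' [Hs' [Hc' [Hnear [Hx'0 Hz'0]]]]]]].
  { now apply is_solution_lienard. }
  { now apply solution_cyclic. }
  { exact Hdl. }
  assert (Hx'b : forall t, - M <= x' t <= M).
  { intros t; destruct (Hnear t) as [s [A _]]; specialize (HM0 s).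
    apply Rabs_def2 in A; apply Rabs_le_between in HM0; unfold M; lra. }
  set (y' := fun t => z' t + prim lam d (x' t)).
  set (G' := fun P : pt => exists t, P = (x' t, y' t)).
  assert (HG' : same_set G' G).
  { apply Hiso.
    - destruct Hc' as [HT' [Hpx' [Hpz' [t Ht]]]].
      exists x', y', T'; split; [now apply (lienard_is_solution d lam M)|].
      split; [exact HT'|split; [|split]].
      + intros s; unfold y'; rewrite Hpx', Hpz'; now split.
      + exists t; intros E; apply Ht; injection E; unfold y'; intros E2 E1.
        rewrite E1 in *; f_equal; lra.
      + intros P; reflexivity.
    - intros P [t ->]; destruct (Hnear t) as [s [A B]]; apply (Htube s).
      + nra.
      + assert (A2 := proj2 HL (x' t) (x s)); unfold g in A2.
        rewrite !clamp_id in A2 by auto; unfold y'.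
        replace (z' t + prim lam d (x' t) - y s)
          with ((z' t - (y s - prim lam d (x s))) + (prim lam d (x' t) - prim lam d (x s))) by ring.
        eapply Rle_lt_trans; [apply Rabs_triang|].
        assert (L * Rabs (x' t - x s) <= L * dl) by (apply Rmult_le_compat_l; lra).
        lra. }
  assert (Hin : G (x' 0, y' 0)) by (apply HG'; now exists 0).
  apply HG in Hin; destruct Hin as [t E]; injection E; intros E2 E1.
  specialize (Hz'0 t); unfold y' in E2; rewrite E1 in E2; lra.
Qed.

Lemma no_periodic_orbit_of_odd_part_signed (d : nat) (lam : nat -> R) (r K : R) (G : pset) :
  0 < r -> 0 <= K ->
  ((forall u v, 0 < u < r -> 0 < v < r ->
      - (K * Rabs (u ^ 2 - v ^ 2)) < prim lam d u - prim lam d (- v)) \/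
   (forall u v, 0 < u < r -> 0 < v < r ->
      - (K * Rabs (u ^ 2 - v ^ 2)) < prim lam d (- u) - prim lam d v)) ->
  periodic_orbit d lam G -> ~ subset G (fun P => dist2 P origin < r ^ 2).
Proof.
  intros Hr HK Hsign [x [y [T [Hs [HT [Hp [Hne HG]]]]]]] Hsub.
  assert (Hxr : forall t, Rabs (x t) < r).
  { intros t; assert (H := Hsub (x t, y t) (proj2 (HG _) (ex_intro _ t eq_refl))).
    unfold dist2, origin in H; simpl fst in H; simpl snd in H.
    rewrite <- (Rabs_pos_eq r) by lra; apply Rsqr_lt_abs_0; unfold Rsqr.
    generalize (pow2_ge_0 (y t - 0)); lra. }
  assert (Hr0 : 0 <= r) by lra.
  destruct (prim_clamp_lipschitz lam d r Hr0) as [L HL].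
  set (g := fun u => prim lam d (clamp (- r) r u)) in *.
  assert (Hg0 : g 0 = 0) by (unfold g; rewrite clamp_id by lra; apply prim_0).
  assert (Hlie : lienard g x (fun t => y t - prim lam d (x t))).
  { apply is_solution_lienard; [exact Hs|]; intros t.
    specialize (Hxr t); apply Rabs_def2 in Hxr; lra. }
  assert (Hcyc : cyclic T x (fun t => y t - prim lam d (x t))) by now apply solution_cyclic.
  destruct Hsign as [H|H].
  - apply (no_cyclic_of_odd_part_pos L K r g x (fun t => y t - prim lam d (x t)) T HL Hg0 HK); auto.
    intros u v Hu Hv; unfold g; rewrite !clamp_id by lra; auto.
  (* The other sign is brought to the first by time reversal, which reflects [g]. *)
  - apply (no_cyclic_of_odd_part_pos L K r (fun u => g (- u)) (fun t => - x (0 - t))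
      (fun t => y (0 - t) - prim lam d (x (0 - t))) T).
    + now apply lipschitz_reverse.
    + now rewrite Ropp_0.
    + exact HK.
    + intros u v Hu Hv; unfold g; rewrite !clamp_id, Ropp_involutive by lra; auto.
    + now apply (lienard_reverse g x (fun t => y t - prim lam d (x t)) 0).
    + now apply (cyclic_reverse T x (fun t => y t - prim lam d (x t))).
    + intros t; rewrite Rabs_Ropp; apply Hxr.
Qed.

Theorem theorem1p4 (d : nat) (Hd : (2 <= d)%nat) (lam : nat -> R) :
  exists U : pset,
    (exists r, 0 < r /\ forall P, dist2 P origin < r ^ 2 -> U P) /\
    forall (k : nat) (C : nat -> pset),
      (forall i, (i < k)%nat -> limit_cycle d lam (C i) /\ subset (C i) U) ->
      (forall i j, (i < k)%nat -> (j < k)%nat -> i <> j -> ~ same_set (C i) (C j)) ->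
      (k <= Nat.div2 d - 1)%nat.
Proof.
  assert (H : exists r, 0 < r /\ forall G, limit_cycle d lam G ->
    ~ subset G (fun P => dist2 P origin < r ^ 2)).
  { destruct (prim_even_or_odd_part_signed lam d) as [Hev|[r [K [Hr [HK Hsign]]]]].
    (* In the even case there is no limit cycle in the whole plane, so any radius will do. *)
    - exists 1; split; [lra|]; intros G HG.
      exfalso; now apply (no_limit_cycle_of_even d lam G).
    - exists r; split; [exact Hr|]; intros G [HG _].
      now apply (no_periodic_orbit_of_odd_part_signed d lam r K). }
  destruct H as [r [Hr H]].
  exists (fun P => dist2 P origin < r ^ 2); split; [now exists r|].
  (* A nonempty family would put a limit cycle inside the disc, so only the count 0 remains. *)
  intros [|k] C HC _; [lia|].
  destruct (HC 0%nat) as [HC1 HC2]; [lia|].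
  exfalso; now apply (H (C 0%nat)).
Qed.
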